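(* Let $f:\mathbb{T}\to[0,1]$ be measurable and let $p,q\in[0,1]$. Then the following three conditions are equivalent: $\mu_p\preccurlyeq\mathbb{P}^f$; $p\le \mathrm{GM}(f)$; $\mu_p\preccurlyeq_{\rm s}\mathbb{P}^f$. Similarly, the following three conditions are equivalent: $\mathbb{P}^f\preccurlyeq\mu_q$; $q\ge 1-\mathrm{GM}(\mathbf{1}-f)$; $\mathbb{P}^f\preccurlyeq_{\rm s}\mu_q$. In addition, for any stationary process on $\{0,1\}^{\mathbb{Z}}$ with law $\mu$ that has conditional negative association, and any $p\in[0,1]$, we have $\mu_p\preccurlyeq\mu$ if and only if $\mu_p\preccurlyeq_{\rm s}\mu$.
   Context: $\mathbb{T}:=\mathbb{R}/\mathbb{Z}$ with unit Lebesgue measure $\lambda_1$; $\widehat f(k):=\int_{\mathbb{T}} f(x)e^{-2\pi i kx}\,d\lambda_1(x)$. For measurable $f:\mathbb{T}\to[0,1]$, $\mathbb{P}^f$ is the unique Borel probability measure on $\{0,1\}^{\mathbb{Z}}$ such that for all $k\ge1$ and all distinct $e_1,\dots,e_k\in\mathbb{Z}$, $\mathbb{P}^f[\eta(e_1)=1,\dots,\eta(e_k)=1]=\det[\widehat f(e_j-e_i)]_{1\le i,j\le k}$ (it exists and is translation invariant). $\mathrm{GM}(f):=\exp\int_{\mathbb{T}}\log f\,d\lambda_1$ (with $\log 0=-\infty$, $\exp(-\infty)=0$). $\mu_p$ is the product measure on $\{0,1\}^{\mathbb{Z}}$ with density $p$ of 1s. $\mathbf 1$ is the constant function 1. Stochastic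 domination: $\nu\preccurlyeq\mu$ means $\nu(A)\le\mu(A)$ for every increasing (Borel) set $A\subseteq\{0,1\}^{\mathbb{Z}}$, where $A$ is increasing if $\eta\in A$ and $\eta\le\delta$ coordinatewise imply $\delta\in A$. Strong domination: for a stationary process $\{\eta_n\}_{n\in\mathbb{Z}}$ with law $\nu$, $\mu_p\preccurlyeq_{\rm s}\nu$ means that for any $n$ and any $a_1,\dots,a_n\in\{0,1\}$ (with conditioning event of positive probability), $\nu[\eta_0=1\mid\eta_i=a_i,\ i=1,\dots,n]\ge p$. Similarly $\nu\preccurlyeq_{\rm s}\mu_p$ is defined with $\ge$ replaced by $\le$. Negative associations: a probability measure on $\{0,1\}^{E}$ has negative associations if any two increasing events that are measurable with respect to the values of $\eta$ on disjoint subsets of $E$ are negatively correlated ($P(A\cap B)\le P(A)P(B)$). $\mu$ has conditional negative association if for every finite $A\subset\mathbb{Z}$ and every $\eta_0\in\{0,1\}^A$ (with conditioning event of positive probability), $\mu[\,\cdot\mid\eta\restriction A=\eta_0]$ has negative associations. *)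

(* Defs.v *)
From mathcomp Require Import all_boot all_order all_algebra.
From mathcomp Require Import complex.
From mathcomp Require Import all_classical all_reals all_analysis.

Set Implicit Arguments.
Unset Strict Implicit.
Unset Printing Implicit Defensive.

Import Order.TTheory GRing.Theory Num.Theory.
Import numFieldNormedType.Exports.

Local Open Scope classical_set_scope.
Local Open Scope ring_scope.

(* A function on the torus R/Z is represented by a 1-periodic function on R;
   the integral against the unit Lebesgue measure of R/Z is the integral over
   the fundamental domain [0, 1[. *)
Definition torus_measurable (R : realType) (f : R -> R) : Prop :=
  measurable_fun [set: R] f /\ periodic f 1.

Definition torus_integralC (R : realType) (g : R -> R[i]) : R[i] :=
  (\int[@lebesgue_measure R]_(x in `[0, 1[) complex.Re (g x)
   +i* \int[@lebesgue_measure R]_(x in `[0, 1[) complex.Im (g x))%C.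

Definition cis (R : realType) (t : R) : R[i] := (cos t +i* sin t)%C.

Definition fourier_coef (R : realType) (f : R -> R) (k : int) : R[i] :=
  torus_integralC (fun x => (f x)%:C%C * cis (- (2 * pi * k%:~R * x))).

(* Extended-real valued, with lne 0 = -oo and expeR -oo = 0. *)
Definition GM (R : realType) (f : R -> R) : \bar R :=
  expeR (\int[@lebesgue_measure R]_(x in `[0%R, 1%R[) lne (f x)%:E)%E.

(* {0,1}^Z with the Borel sigma-algebra of the product topology. *)
Definition config : Type :=
  g_sigma_algebraType (@open (prod_topology (fun _ : int => bool))).

(* The defining property of P^f, which determines P uniquely. *)
Definition determinantal (R : realType) (f : R -> R)
    (P : probability config R) : Prop :=
  forall (k : nat) (e : 'I_k -> int), (0 < k)%N -> injective e ->
    (fine (P [set eta : config | forall i, eta (e i) = true]))%:C%C =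
    \det (\matrix_(i < k, j < k) fourier_coef f (e j - e i)).

(* The finite-dimensional distributions of mu_p, which determine it. *)
Definition bernoulli_product (R : realType) (p : R)
    (mu : probability config R) : Prop :=
  forall (k : nat) (e : 'I_k -> int) (a : 'I_k -> bool), injective e ->
    mu [set eta : config | forall i, eta (e i) = a i] =
    (\prod_(i < k) (if a i then p else 1 - p))%:E.

Definition increasing_event (A : set config) : Prop :=
  forall eta delta : config,
    A eta -> (forall i, (eta i <= delta i)%O) -> A delta.

Definition stoch_dominated (R : realType) (nu mu : probability config R) :
    Prop :=
  forall A : set config, measurable A -> increasing_event A ->
    (nu A <= mu A)%E.

Definition stationary (R : realType) (mu : probability config R) : Prop :=
  forall (n : int) (A : set config), measurable A ->
    mu [set eta : config | A (fun i => eta (i + n))] = mu A.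

(* mu[A | B]; only meaningful when 0 < mu B. *)
Definition cond_prob (R : realType) (mu : probability config R)
    (B A : set config) : R :=
  fine (mu (A `&` B)) / fine (mu B).

(* The event eta_1 = a_1, ..., eta_n = a_n; indices of a are shifted by 1. *)
Definition future_event (n : nat) (a : 'I_n -> bool) : set config :=
  [set eta : config | forall i : 'I_n, eta (i.+1%:Z) = a i].

Definition product_strongly_dominated (R : realType) (p : R)
    (nu : probability config R) : Prop :=
  forall (n : nat) (a : 'I_n -> bool), (0 < nu (future_event a))%E ->
    p <= cond_prob nu (future_event a) [set eta : config | eta 0 = true].

Definition strongly_dominated_product (R : realType)
    (nu : probability config R) (p : R) : Prop :=
  forall (n : nat) (a : 'I_n -> bool), (0 < nu (future_event a))%E ->
    cond_prob nu (future_event a) [set eta : config | eta 0 = true] <= p.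

(* The events measurable with respect to the values of eta on F. *)
Definition coord_sigma_algebra (F : set int) : set (set config) :=
  <<s [set [set eta : config | eta i = true] | i in F] >>.

(* Stated for a set function so as to apply to mu[. | B]. *)
Definition negatively_associated (R : realType) (m : set config -> R) : Prop :=
  forall (F G : set int) (A B : set config),
    F `&` G = set0 ->
    coord_sigma_algebra F A -> coord_sigma_algebra G B ->
    increasing_event A -> increasing_event B ->
    m (A `&` B) <= m A * m B.

Definition cond_negatively_associated (R : realType)
    (mu : probability config R) : Prop :=
  forall (A : set int) (eta0 : config), finite_set A ->
    let C := [set eta : config | forall i, A i -> eta i = eta0 i] in
    (0 < mu C)%E -> negatively_associated (cond_prob mu C).

(* Main.v *)
(** Each of the three sets of conditions is reduced to the growth of
    [D n = P(eta_1 = ... = eta_n = 1)].  Domination of [mu_p] forces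
    [p ^ n <= D n].  If any two sites are negatively correlated given any
    pattern elsewhere, then [D (n+1) / D n] is nonincreasing, hence at least
    [p], and it is the smallest conditional probability of a 1 at the origin:
    adding a 1 to the conditioning lowers this probability, adding a 0 raises
    it.  So [p ^ n <= D n] for all [n] gives strong domination.  Strong
    domination gives domination of increasing events depending on finitely many
    sites by integrating out one site at a time, and of Borel ones by inner
    regularity, the up-closure of a compact set being a decreasing limit of
    clopen increasing sets.

    For [P^f], the probability of a pattern is, up to sign, the determinant of
    [K - diag(1 at the zeros)], and negative correlation is the
    Desnanot-Jacobi identity for a Hermitian matrix.  Here [D n] is a Toeplitz
    determinant, and [p ^ n <= D n] for all [n] is equivalent to
    [p <= GM f] by Szego's theorem.  The latter is obtained from an orthonormal
    eigenbasis [v_i] of the Toeplitz matrix: the squared moduli of the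
    corresponding trigonometric polynomials are probability densities [w_i] with
    [sum_i w_i = n], the eigenvalues are [int f w_i], and
    [sum_i lam_i w_i] is [n] times a Fejer mean of [f], so both bounds follow
    from the concavity of the logarithm.  Exchanging zeros and ones turns [f]
    into [1 - f], which gives the second equivalence. *)

From HB Require Import structures.
Require Import Defs.
From mathcomp Require Import all_boot all_order all_algebra.
From mathcomp Require Import complex.
From mathcomp Require Import all_classical all_reals all_analysis measurable_realfun.
From mathcomp Require Import ring lra.
From mathcomp Require Import zify.

Set Implicit Arguments.
Unset Strict Implicit.
Unset Printing Implicit Defensive.

Import Order.TTheory GRing.Theory Num.Theory.
Import numFieldNormedType.Exports.

Local Open Scope classical_set_scope.
Local Open Scope ring_scope.

(** * Cylinder events *)

(** Constraints are kept in a list so that prescribing one more site is a [cons]; a list that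
    prescribes both values at a site gives the empty event. *)
Definition pat (s : seq (int * bool)) : set config :=
  [set eta : config | all (fun x => eta x.1 == x.2) s].

Lemma pat_cons i b s :
  pat ((i, b) :: s) = [set eta : config | eta i = b] `&` pat s.
Proof.
by apply/seteqP; split=> eta /= => [/andP[/eqP]//|[/eqP e s1]]; apply/andP.
Qed.

Lemma pat_perm s t : perm_eq s t -> pat s = pat t.
Proof. by move=> st; apply/seteqP; split=> eta; rewrite /pat/= (perm_all _ st). Qed.

Lemma open_coord (i : int) (b : bool) :
  @open (prod_topology (fun _ : int => bool)) [set eta | eta i = b].
Proof.
have : @open (prod_topology (fun _ : int => bool)) (@proj int (fun=> bool) i @^-1` [set b]).
  apply: open_comp; last exact: discrete_open.
  by move=> x _; exact: proj_continuous.
by [].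
Qed.

Lemma measurable_coord (i : int) (b : bool) :
  measurable [set eta : config | eta i = b].
Proof. by apply: sub_sigma_algebra; exact: open_coord. Qed.

Lemma measurable_pat s : measurable (pat s).
Proof.
elim: s => [|[i b] s ih]; last first.
  by rewrite pat_cons; apply: measurableI => //; exact: measurable_coord.
by rewrite (_ : pat _ = setT)//; apply/seteqP; split.
Qed.
#[local] Hint Resolve measurable_pat measurable_coord : core.

Section patterns.
Variables (R : realType) (nu : probability config R).

Definition patP (s : seq (int * bool)) : R := fine (nu (pat s)).

Lemma patP_EFin s : (patP s)%:E = nu (pat s).
Proof. by rewrite /patP fineK// fin_num_measure. Qed.

Lemma patP_ge0 s : 0 <= patP s.
Proof. by rewrite fine_ge0. Qed.

Lemma patP_perm s t : perm_eq s t -> patP s = patP t.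
Proof. by move=> st; rewrite /patP (pat_perm st). Qed.

Lemma patP_nil : patP [::] = 1.
Proof.
rewrite /patP (_ : pat _ = setT) ?probability_setT//.
by apply/seteqP; split.
Qed.

Lemma patP_split i s : patP ((i, true) :: s) + patP ((i, false) :: s) = patP s.
Proof.
apply: EFin_inj; rewrite EFinD !patP_EFin -measureU//.
- congr (nu _); rewrite !pat_cons; apply/seteqP; split=> [eta [[]|[]]//|eta s1] /=.
  by case e : (eta i); [left|right].
- by rewrite !pat_cons; apply/seteqP; split=> eta //= [[/= -> _] []].
Qed.

Lemma patP_sub s t : {subset s <= t} -> patP t <= patP s.
Proof.
move=> st; rewrite -lee_fin !patP_EFin le_measure ?inE// => eta /= /allP t1.
by apply/allP => x /st/t1.
Qed.

End patterns.

(** * Shifts, windows and runs of ones *)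

Definition shift_pat (k : int) (s : seq (int * bool)) :=
  [seq (x.1 + k, x.2) | x <- s].

(** The property common to determinantal processes and to conditional negative association. It is
    cleared of denominators so that patterns of probability 0 are covered. *)
Definition pairwise_cond_neg_corr (R : realType) (nu : probability config R) :=
  forall (i j : int) (s : seq (int * bool)),
    uniq (i :: j :: map fst s) ->
    patP nu ((i, true) :: (j, true) :: s) * patP nu s <=
    patP nu ((i, true) :: s) * patP nu ((j, true) :: s).

Definition ones (m : int) (n : nat) : seq (int * bool) :=
  [seq (m + k%:Z, true) | k <- iota 0 n].

Definition window (m : int) (a : seq bool) : seq (int * bool) :=
  [seq (m + x.1%:Z, x.2) | x <- zip (iota 0 (size a)) a].

Lemma window_cons m b a : window m (b :: a) = (m, b) :: window (m + 1) a.
Proof.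
rewrite /window/= addr0; congr cons.
elim: a 0%N => //= c a ih n; congr cons; last exact: ih.
by rewrite -addrA -intS.
Qed.

(** If one ratio [c] were below [p], log-concavity would keep all later ratios below or at [c], and
    [D] would eventually decay faster than the powers of [p]. *)
Lemma log_concave_ratio_ge (R : realType) (D : nat -> R) (p : R) :
    0 < p -> (forall n, p ^+ n <= D n) ->
    (forall n, D n.+2 * D n <= D n.+1 * D n.+1) ->
  forall n, p * D n <= D n.+1.
Proof.
move=> p0 pD Dlc n; rewrite leNgt; apply/negP => lt.
have D0 k : 0 < D k by apply: lt_le_trans (pD k); rewrite exprn_gt0.
pose c := D n.+1 / D n.
have c0 : 0 < c by rewrite divr_gt0.
have cp : c < p by rewrite ltr_pdivrMr.
have ratio k : D (n + k).+1 <= c * D (n + k)%N.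
  elim: k => [|k ih]; first by rewrite addn0 /c divfK ?gt_eqF.
  rewrite addnS -(ler_pM2r (D0 (n + k)%N)); apply: le_trans (Dlc _) _.
  by rewrite -mulrA mulrCA ler_pM2l.
have bound k : D (n + k)%N <= c ^+ k * D n.
  elim: k => [|k ih]; first by rewrite addn0 expr0 mul1r.
  rewrite addnS exprS -mulrA; apply: le_trans (ratio k) _.
  by rewrite ler_pM2l.
have xp0 : 0 <= c / p by rewrite divr_ge0 ?ltW.
have xp1 : `|c / p| < 1 by rewrite ger0_norm// ltr_pdivrMr// mul1r.
(* With this threshold, [(c / p) ^+ k] being small enough means [c ^+ k * D n < p ^+ (n + k)]. *)
have eps : 0 < p ^+ n / D n by rewrite divr_gt0// exprn_gt0.
have /cvgrPdist_lt/(_ _ eps)[k _ /(_ k (leqnn k))] := cvg_expr xp1.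
rewrite /= sub0r normrN ger0_norm ?exprn_ge0// expr_div_n ltr_pdivlMr//.
rewrite mulrAC ltr_pdivrMr ?exprn_gt0// -exprD ltNge.
by rewrite (le_trans (pD _) (bound k)).
Qed.

Lemma onesS m n : ones m n.+1 = (m, true) :: ones (m + 1) n.
Proof.
rewrite /ones /= addr0; congr cons; rewrite -[1%N]addn0 iotaDl -map_comp.
by apply: eq_map => k /=; rewrite PoszD addrA.
Qed.

Lemma ones_rcons m n : ones m n.+1 = rcons (ones m n) (m + n%:Z, true).
Proof. by rewrite /ones -addn1 iotaD map_cat/= add0n cats1. Qed.

Lemma mem_ones m n x : (x \in ones m n) = (m <= x.1 < m + n%:Z) && x.2.
Proof.
apply/mapP/idP => [[k + ->]/=|]; first by rewrite mem_iota; lia.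
case: x => i [] /= h; last by rewrite andbF in h.
by exists (`|i - m|%N); [rewrite mem_iota|congr pair]; lia.
Qed.

Lemma uniq_ones m n : uniq (map fst (ones m n)).
Proof. by rewrite -map_comp map_inj_uniq ?iota_uniq// => x y /=; lia. Qed.

Lemma shift_ones k m n : shift_pat k (ones m n) = ones (m + k) n.
Proof. by rewrite /shift_pat -map_comp; apply: eq_map => i /=; rewrite addrAC. Qed.

(** * Strong domination from the probabilities of runs of ones *)

Section strong_domination.
Variables (R : realType) (nu : probability config R) (p : R).
Hypothesis p_ge0 : 0 <= p.
Hypothesis nu_shift : forall k s, uniq (map fst s) ->
  patP nu (shift_pat k s) = patP nu s.
Hypothesis nu_pnc : pairwise_cond_neg_corr nu.
Hypothesis p_ones : forall n, p ^+ n <= patP nu (ones 1 n).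

Lemma patP_ones m n : patP nu (ones m n) = patP nu (ones 1 n).
Proof. by rewrite -(nu_shift (1 - m)) ?uniq_ones// shift_ones addrC subrK. Qed.

(** Negative correlation of the two end sites of a run of [n + 2] ones, given the [n] inner ones, is
    log-concavity of the run probabilities. *)
Lemma ones_ratio n : p * patP nu (ones 1 n) <= patP nu ((0, true) :: ones 1 n).
Proof.
have [p0|] := ltrP 0 p; last first.
  move=> p0; have -> : p = 0 by apply/le_anti; rewrite p0.
  by rewrite mul0r patP_ge0.
rewrite -[X in patP nu (_ :: ones X n)]add0r -onesS patP_ones.
apply: (log_concave_ratio_ge p0 p_ones) => {}n.
have e0 m : (0, true) :: ones 1 m = ones 0 m.+1 by rewrite onesS add0r.
have e1 : perm_eq ((n.+1%:Z, true) :: ones 1 n) (ones 1 n.+1).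
  by rewrite ones_rcons perm_sym perm_rcons intS.
have e2 : perm_eq [:: (0, true), (n.+1%:Z, true) & ones 1 n] (ones 0 n.+2).
  by rewrite -e0 perm_cons.
have := @nu_pnc 0 (n.+1)%:Z (ones 1 n) _.
rewrite (patP_perm nu e1) (patP_perm nu e2) e0 (patP_ones 0 n.+1) (patP_ones 0 n.+2).
apply.
rewrite /= uniq_ones andbT inE negb_or; apply/andP; split; last first.
  by apply/mapP => -[[i b]]; rewrite mem_ones /=; lia.
by apply/andP; split; [lia | apply/mapP => -[[i b]]; rewrite mem_ones /=; lia].
Qed.

(** The conditional probability of a 1 at the origin given [s], used only when [s] has positive
    probability. *)
Let q s := patP nu ((0, true) :: s) / patP nu s.

Lemma q_one_le t s : uniq (0 :: t :: map fst s) ->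
  0 < patP nu ((t, true) :: s) -> q ((t, true) :: s) <= q s.
Proof.
move=> us ts0; have s0 : 0 < patP nu s.
  by apply: lt_le_trans ts0 _; apply: patP_sub => x; rewrite inE orbC => ->.
by rewrite /q ler_pdivrMr// mulrAC ler_pdivlMr// nu_pnc.
Qed.

(** The value [q s] averages the values given a 1 and given a 0 at [t]; since a 1 lowers it, a 0
    raises it. *)
Lemma q_zero_ge t s : uniq (0 :: t :: map fst s) ->
  0 < patP nu ((t, false) :: s) -> q s <= q ((t, false) :: s).
Proof.
move=> us ts0; have s0 : 0 < patP nu s.
  by apply: lt_le_trans ts0 _; apply: patP_sub => x; rewrite inE orbC => ->.
rewrite /q ler_pdivlMr// mulrAC ler_pdivrMr//.
have := nu_pnc us.
have := patP_split nu t s; have := patP_split nu t ((0, true) :: s).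
rewrite (@patP_perm _ nu [:: (t, true), (0, true) & s] [:: (0, true), (t, true) & s]);
  last by rewrite (perm_catCA [:: (t, true)] [:: (0, true)] s).
rewrite (@patP_perm _ nu [:: (t, false), (0, true) & s] [:: (0, true), (t, false) & s]);
  last by rewrite (perm_catCA [:: (t, false)] [:: (0, true)] s).
set a := patP nu _; set b := patP nu _; set c := patP nu _.
set d := patP nu _; set e := patP nu _; set f := patP nu _.
by move=> <- <-; nra.
Qed.

Lemma q_ones_le T S : uniq (0 :: map fst (T ++ S)) -> all snd T ->
  0 < patP nu (T ++ S) -> q (T ++ S) <= q S.
Proof.
elim: T => //= -[t b] T ih /= u /andP[/= bT Tt] TS0; rewrite {}bT in TS0 *.
apply: le_trans (q_one_le u TS0) _; apply: ih => //.
  by case/andP: u; rewrite inE negb_or /= => /andP[_ ->] /andP[].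
by apply: lt_le_trans TS0 _; apply: patP_sub => x; rewrite inE orbC => ->.
Qed.

Lemma q_zeros_ge T S : uniq (0 :: map fst (T ++ S)) -> all (predC snd) T ->
  0 < patP nu (T ++ S) -> q S <= q (T ++ S).
Proof.
elim: T => //= -[t b] T ih /= u /andP[/negPf/= bT Tt] TS0; rewrite {}bT in TS0 *.
apply: le_trans _ (q_zero_ge u TS0); apply: ih => //.
  by case/andP: u; rewrite inE negb_or /= => /andP[_ ->] /andP[].
by apply: lt_le_trans TS0 _; apply: patP_sub => x; rewrite inE orbC => ->.
Qed.

Lemma strong_window a : p * patP nu (window 1 a) <=
  patP nu ((0, true) :: window 1 a).
Proof.
have [p0|] := ltrP 0 p; last first.
  move=> p0; have -> : p = 0 by apply/le_anti; rewrite p0.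
  by rewrite mul0r patP_ge0.
have [w0|w0] := ltrP 0 (patP nu (window 1 a)); last first.
  rewrite (le_trans _ (patP_ge0 _ _))// pmulr_rle0//.
pose w := window 1 a.
(* [Z] and [S] collect the zeros and the ones of the window, and [T] is [Z] with its zeros turned
   into ones. Then [q] increases along [T ++ S], [S], [Z ++ S], and [T ++ S] is a run of ones. *)
pose Z := [seq x <- w | ~~ x.2]; pose S := [seq x <- w | x.2].
pose T := [seq (x.1, true) | x <- Z].
have wZS : perm_eq w (Z ++ S) by rewrite perm_sym perm_catC perm_filterC.
have fw : map fst w = [seq 1 + k%:Z | k <- iota 0 (size a)].
  rewrite /w /window -map_comp.
  rewrite (eq_map (_ : _ =1 (fun k : nat => 1 + k%:Z) \o fst))// map_comp.
  by rewrite -/unzip1 unzip1_zip// size_iota.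
have ow : perm_eq (T ++ S) (ones 1 (size a)).
  have -> : ones 1 (size a) = [seq (x.1, true) | x <- w].
    rewrite (eq_map (_ : _ =1 (pair^~ true) \o fst))// map_comp fw -map_comp.
    exact: eq_map.
  rewrite (perm_trans _ (perm_map _ (_ : perm_eq (Z ++ S) w)))//; last first.
    by rewrite perm_sym.
  rewrite map_cat -/T (_ : [seq _ | x <- S] = S)//; apply: map_id_in => -[i b].
  by rewrite mem_filter /= => /andP[->].
have uw : uniq (0 :: map fst w).
  rewrite fw /= map_inj_uniq ?iota_uniq ?andbT; last by move=> x y; lia.
  by apply/mapP => -[k _]; lia.
have uZS : uniq (0 :: map fst (Z ++ S)).
  by move: uw => /=; rewrite (perm_mem (perm_map _ wZS)) (perm_uniq (perm_map _ wZS)).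
have uTS : uniq (0 :: map fst (T ++ S)).
  by move: uZS; rewrite !map_cat -map_comp.
have wZS0 : perm_eq ((0, true) :: w) ((0, true) :: (Z ++ S)) by rewrite perm_cons.
rewrite -/w (patP_perm nu wZS) (patP_perm nu wZS0).
have ZS0 : 0 < patP nu (Z ++ S) by rewrite -(patP_perm nu wZS).
(* The lower bound [p ^+ n] is what makes conditioning on all ones legitimate. *)
have TS0 : 0 < patP nu (T ++ S).
  by rewrite (patP_perm nu ow); apply: lt_le_trans (p_ones _); rewrite exprn_gt0.
rewrite -ler_pdivlMr//; apply: le_trans _ (q_zeros_ge uZS _ ZS0); last first.
  by apply/allP => -[i b]; rewrite mem_filter => /andP[].
apply: le_trans _ (q_ones_le uTS _ TS0); last by apply/allP => x /mapP[? _ ->].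
rewrite /q ler_pdivlMr// (patP_perm nu ow).
have ow0 : perm_eq ((0, true) :: (T ++ S)) ((0, true) :: ones 1 (size a)).
  by rewrite perm_cons.
rewrite (patP_perm nu ow0).
exact: ones_ratio.
Qed.

End strong_domination.

(** * Stochastic domination *)

(** The sum over all words of length [n], recursive in the first letter so that inductions peel off
    the leftmost site. *)
Fixpoint bsum (R : realType) (n : nat) (F : seq bool -> R) : R :=
  if n is n'.+1 then
    bsum n' (fun a => F (true :: a)) + bsum n' (fun a => F (false :: a))
  else F [::].

Lemma ler_bsum (R : realType) n (F G : seq bool -> R) :
  (forall a, size a = n -> F a <= G a) -> bsum n F <= bsum n G.
Proof.
elim: n F G => [|n ih] F G FG /=; first exact: FG.
by apply: lerD; apply: ih => a an; apply: FG; rewrite /= an.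
Qed.

Lemma bsumD (R : realType) n (F G : seq bool -> R) :
  bsum n (fun a => F a + G a) = bsum n F + bsum n G.
Proof. by elim: n F G => [|n ih] F G //=; rewrite !ih addrACA. Qed.

(** Since [all2] fails on words of different lengths, only words of equal length are compared. *)
Definition word_increasing (R : realType) (G : seq bool -> R) :=
  forall a b, all2 implb a b -> G a <= G b.

(* Integrating out the leftmost coordinate of the window: replacing the
   conditional probability of a 1 by [p] turns [G] into the increasing function
   [p * G (true :: a) + (1 - p) * G (false :: a)]. *)
Lemma word_domination (R : realType) (mu nu : probability config R) (p : R) :
    0 <= p <= 1 ->
    (forall m a, p * patP nu (window (m + 1) a) <= patP nu ((m, true) :: window (m + 1) a)) ->
    (forall m a, patP mu ((m, true) :: window (m + 1) a) <= p * patP mu (window (m + 1) a)) ->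
  forall n m (G : seq bool -> R), word_increasing G ->
  bsum n (fun a => G a * patP mu (window m a)) <=
  bsum n (fun a => G a * patP nu (window m a)).
Proof.
move=> /andP[p0 p1] nup mup; elim=> [|n ih] m G Gi /=.
  by rewrite !patP_nil.
pose G' a := p * G (true :: a) + (1 - p) * G (false :: a).
have G'i : word_increasing G'.
  by move=> a b ab; apply: lerD; rewrite ler_wpM2l ?subr_ge0//; exact: Gi.
have tf a : 0 <= G (true :: a) - G (false :: a).
  by rewrite subr_ge0; apply: Gi => /=; elim: a => //= -[].
(* Site [m] is passed from [mu] to [p], the induction hypothesis is applied to [G'] on the sites to
   its right, and site [m] is then passed from [p] to [nu]. *)
rewrite -!bsumD; apply: (@le_trans _ _ (bsum n (fun a => G' a * patP mu (window (m + 1) a)))).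
  apply: ler_bsum => a _; rewrite !window_cons.
  have := ler_wpM2l (tf a) (mup m a); have := patP_split mu m (window (m + 1) a).
  by rewrite /G' => <-; nra.
apply: le_trans (ih (m + 1) G' G'i) _.
apply: ler_bsum => a _; rewrite !window_cons.
have := ler_wpM2l (tf a) (nup m a); have := patP_split nu m (window (m + 1) a).
by rewrite /G' => <-; nra.
Qed.

Definition word (m : int) (n : nat) (eta : config) : seq bool :=
  [seq eta (m + k%:Z) | k <- iota 0 n].

Lemma wordS m n eta : word m n.+1 eta = eta m :: word (m + 1) n eta.
Proof.
rewrite /word /= addr0; congr cons; rewrite -[1%N]addn0 iotaDl -map_comp.
by apply: eq_map => k /=; rewrite PoszD addrA.
Qed.

Lemma all2_word (r : rel bool) m n (eta delta : config) :
  all2 r (word m n eta) (word m n delta) <->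
  (forall i, m <= i < m + n%:Z -> r (eta i) (delta i)).
Proof.
elim: n m => [|n ih] m; first by split=> // _ i; lia.
rewrite !wordS /=; split=> [/andP[r0 /ih rS] i mi|h].
  by have [->//|im] := eqVneq i m; apply: rS; lia.
by rewrite h ?ih ?andbT; [move=> i ?; apply: h; lia|lia].
Qed.

Lemma pat_window m a eta : pat (window m a) eta <-> word m (size a) eta = a.
Proof.
elim: a m => [|b a ih] m //; rewrite window_cons pat_cons wordS.
by split=> [[/= -> /ih ->]//|[e1 e2]]; split=> //; apply/ih.
Qed.

Lemma measure_word (R : realType) (nu : probability config R) n m A :
  measurable A ->
  fine (nu A) = bsum n (fun a => fine (nu (A `&` pat (window m a)))).
Proof.
elim: n m A => [|n ih] m A mA /=.
  by rewrite (_ : _ `&` _ = A)//; apply/seteqP; split=> [eta []|eta ?]//.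
have mAm b : measurable (A `&` [set eta : config | eta m = b]).
  by apply: measurableI => //; exact: measurable_coord.
rewrite (_ : A = (A `&` [set eta | eta m = true]) `|`
                 (A `&` [set eta | eta m = false])); last first.
  apply/seteqP; split=> [eta Ae|eta [[]|[]]//].
  by case e : (eta m); [left|right].
rewrite measureU//; last first.
  by apply/seteqP; split=> eta //= [[_ ->] [_]].
rewrite fineD ?fin_num_measure// !(ih (m + 1))//.
congr (_ + _); congr (bsum _ _); apply/funext => a; congr (fine (nu _));
  rewrite window_cons pat_cons; apply/seteqP; split=> eta /=.
- by case=> -[Ae e] ew; split; [left|split].
- by case=> -[[Ae e]|[Ae e]] []//= e1; rewrite e in e1.
- by case=> -[Ae e] ew; split; [right|split].
- by case=> -[[Ae e]|[Ae e]] []//= e1; rewrite e in e1.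
Qed.

(** * Clopen events and compactness of the configuration space *)

Local Notation cantorZ := (prod_topology (fun _ : int => bool)).

Definition word_event m n (g : pred (seq bool)) : set config :=
  [set eta | g (word m n eta)].

Lemma open_word_event m n g : @open cantorZ (word_event m n g).
Proof.
elim: n m g => [|n ih] m g.
  rewrite /word_event /word /=; case: (g [::]).
    by rewrite (_ : [set _ | _] = setT); [exact: openT|apply/seteqP; split].
  by rewrite (_ : [set _ | _] = set0); [exact: open0|apply/seteqP; split].
rewrite (_ : word_event _ _ _ =
  ([set eta : cantorZ | eta m = true] `&` word_event (m + 1) n (g \o cons true)) `|`
  ([set eta : cantorZ | eta m = false] `&` word_event (m + 1) n (g \o cons false))); last first.
  apply/seteqP; split=> eta; rewrite /word_event /= wordS.
    by case: (eta m) => ?; [left|right].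
  by case=> -[-> ].
by apply: openU; apply: openI; (exact: open_coord || exact: ih).
Qed.

Lemma closed_word_event m n g : @closed cantorZ (word_event m n g).
Proof.
rewrite -(setCK (word_event m n g)); apply: open_closedC.
rewrite (_ : ~` _ = word_event m n (predC g)); first exact: open_word_event.
by apply/seteqP; split=> eta /negP.
Qed.

Lemma measurable_open (U : set config) : @open cantorZ U -> measurable U.
Proof. by move=> oU; apply: sub_sigma_algebra. Qed.

Lemma measurable_closed (K : set config) : @closed cantorZ K -> measurable K.
Proof.
by move=> cK; rewrite -(setCK K); apply: measurableC; apply: measurable_open;
  exact: closed_openC.
Qed.

Lemma measurable_word_event m n g : measurable (word_event m n g).
Proof. by apply: measurable_open; exact: open_word_event. Qed.

(** The indicator of [g] is an increasing function of the word, and its weighted sum over words is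
    the probability of the event. *)
Lemma word_event_domination (R : realType) (mu nu : probability config R) (p : R) :
    0 <= p <= 1 ->
    (forall m a, p * patP nu (window (m + 1) a) <= patP nu ((m, true) :: window (m + 1) a)) ->
    (forall m a, patP mu ((m, true) :: window (m + 1) a) <= p * patP mu (window (m + 1) a)) ->
  forall n m (g : pred (seq bool)),
  (forall a b, all2 implb a b -> g a -> g b) ->
  (mu (word_event m n g) <= nu (word_event m n g))%E.
Proof.
move=> p01 nup mup n m g gi.
have mW := measurable_word_event m n g.
have E (P : probability config R) : fine (P (word_event m n g)) =
    bsum n (fun a => (g a)%:R * patP P (window m a)).
  rewrite (measure_word P n m mW); apply/eqP.
  suff H a : size a = n -> fine (P (word_event m n g `&` pat (window m a))) =
      (g a)%:R * patP P (window m a).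
    by rewrite eq_le; apply/andP; split; apply: ler_bsum => a /H ->.
  move=> an; rewrite /word_event; case ga : (g a).
    rewrite mul1r /patP; congr (fine (P _)); apply/seteqP; split=> [eta []//|eta pa].
    by split=> //=; move/pat_window : pa; rewrite an => ->.
  rewrite mul0r (_ : _ `&` _ = set0) ?measure0//.
  apply/seteqP; split=> // eta [/= ge /pat_window].
  by rewrite an => e; rewrite e ga in ge.
rewrite -[leLHS]fineK ?fin_num_measure// -[leRHS]fineK ?fin_num_measure// lee_fin !E.
apply: (word_domination p01 nup mup) => a b /gi ab.
by rewrite ler_nat; case: (g a) ab => //= ->.
Qed.

Definition box (N : nat) : config -> seq bool := word (- N%:Z) (N.*2.+1).

Lemma all2_box (r : rel bool) N (eta delta : config) :
  all2 r (box N eta) (box N delta) <->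
  (forall i, - N%:Z <= i <= N%:Z -> r (eta i) (delta i)).
Proof.
rewrite /box all2_word; split=> h i iN; apply: h; lia.
Qed.

Lemma box_inj N (eta delta : config) : box N eta = box N delta <->
  (forall i, - N%:Z <= i <= N%:Z -> eta i = delta i).
Proof.
split=> [e i iN|h]; last first.
  by apply/eq_in_map => k; rewrite mem_iota => kN; apply: h; lia.
apply/eqP; move: i iN; apply/(all2_box eqb); rewrite e.
by elim: (box N delta) => //= b s ->; rewrite andbT; case: b.
Qed.

(** The sets of configurations that agree with [eta] on a box generate a filter converging to [eta]
    in each coordinate, hence in the product topology. *)
Lemma box_nbhs (U : set config) (eta : config) : @open cantorZ U -> U eta ->
  exists N, forall delta, box N eta = box N delta -> U delta.
Proof.
move=> oU Ueta.
pose F : set_system cantorZ :=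
  filter_from setT (fun N : nat => [set delta : cantorZ | box N eta = box N delta]).
have FF : Filter F.
  apply: filter_from_filter; first by exists 0%N.
  move=> M N _ _; exists (maxn M N) => // delta /= /box_inj h.
  by split; apply/box_inj => i iN; apply: h; lia.
have : F --> (eta : cantorZ).
  apply/cvg_sup => i A /= [_ [[C oC <-] Ceta BA]].
  exists `|i|%N => // delta /= /box_inj h.
  by apply: BA; rewrite /= -h//; lia.
move=> /(_ U)[]; first exact: open_nbhs_nbhs.
by move=> N _ h; exists N => delta; exact: h.
Qed.

(** The union of the box cylinders contained in [U]; it is clopen, and it exhausts an open [U] as
    [N] grows. *)
Definition box_interior (N : nat) (U : set config) : set config :=
  word_event (- N%:Z) (N.*2.+1)
    (fun b => `[< forall delta : config, b = box N delta -> U delta >]).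

Lemma bigcup_box_interior (U : set config) : @open cantorZ U ->
  \bigcup_N box_interior N U = U.
Proof.
move=> oU; apply/seteqP; split=> [eta [N _ /asboolP]|eta Ue]; first exact.
by have [N UN] := box_nbhs oU Ue; exists N => //; apply/asboolP.
Qed.

Lemma closed_compact_config (K : set cantorZ) : closed K -> compact K.
Proof.
move=> cK; apply: (subclosed_compact cK (B := setT)) => //.
have := @tychonoff int (fun=> bool) (fun=> setT) (fun=> bool_compact).
by rewrite (_ : [set f | _] = setT)//; apply/seteqP; split.
Qed.

(** The up-closure of [K] as seen on the box: a clopen increasing event that contains [K] and
    decreases with [N]. *)
Definition up_box (N : nat) (K : set config) : set config :=
  word_event (- N%:Z) (N.*2.+1)
    (fun b => `[< exists2 eta, K eta & all2 implb (box N eta) b >]).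

Lemma up_boxP N K delta : up_box N K delta <->
  exists2 eta, K eta & forall i, - N%:Z <= i <= N%:Z -> (eta i <= delta i)%O.
Proof.
split=> [/asboolP[eta Ke /all2_box h]|[eta Ke h]].
  by exists eta => // i /h; case: (eta i) (delta i) => [] [].
by apply/asboolP; exists eta => //; apply/all2_box => i /h;
  case: (eta i) (delta i) => [] [].
Qed.

(** Each [N] supplies a point of [K] that lies below [delta] on the box; by compactness these points
    have a cluster point in [K], and it lies below [delta] everywhere. *)
Lemma bigcap_up_box (K : set config) (delta : config) : @closed cantorZ K ->
  (forall N, up_box N K delta) ->
  exists2 eta, K eta & forall i, (eta i <= delta i)%O.
Proof.
move=> /closed_compact_config cK /(_ _)/up_boxP h.
have {h}/choice[u hu] N : exists eta : cantorZ,
    K eta /\ (forall i, - N%:Z <= i <= N%:Z -> (eta i <= delta i)%O).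
  by have [eta] := h N; exists eta.
have uK : (u @ \oo) K by exists 0%N => // N _ /=; have [] := hu N.
have [eta [Ke clu]] := cK (u @ \oo) _ uK.
exists eta => // i; rewrite leNgt; apply/negP => lt.
have [e1 e2] : eta i = true /\ delta i = false.
  by case: (eta i) (delta i) lt => [] [].
(* At a site where the cluster point is 1 and [delta] is 0, the clopen neighbourhood fixing that 1
   would have to meet the tail of [u], which is 0 there. *)
have [] := clu [set x : cantorZ | (x i <= delta i)%O] [set x : cantorZ | x i = true].
- by exists `|i|%N => // N /= iN; have [_] := hu N; apply; lia.
- by apply: open_nbhs_nbhs; split=> //; exact: open_coord.
- by move=> x /= [+ e]; rewrite e e2.
Qed.

(** * Inner regularity by closed sets *)

Section regularity.
Variables (R : realType) (mu : probability config R).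

Lemma nondecreasing_approx (F : (set config)^nat) (eps : R) : 0 < eps ->
  (forall N, measurable (F N)) -> nondecreasing_seq F ->
  exists N, (mu ((\bigcup_n F n) `\` F N) <= eps%:E)%E.
Proof.
move=> eps0 mF ndF; have mU : measurable (\bigcup_n F n) by exact: bigcup_measurable.
have := nondecreasing_cvg_mu (mu := mu) mF mU ndF.
rewrite -[X in _ --> X]fineK ?fin_num_measure//.
move=> /fine_cvgP[_] /cvgrPdist_lt/(_ _ eps0)[N _ /(_ N (leqnn N))] /= hN.
exists N; rewrite measureD//; last by rewrite -ge0_fin_numE ?fin_num_measure.
rewrite setIidr; last exact: bigcup_sup.
rewrite -[X in (X - _)%E]fineK ?fin_num_measure//.
rewrite -[X in (_ - X)%E]fineK ?fin_num_measure// -EFinB lee_fin ltW//.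
exact: le_lt_trans (ler_norm _) hN.
Qed.

(* Symmetric in [A] and its complement, so that closure under complements is
   immediate. *)
Let approximable (A : set config) := forall eps : R, 0 < eps ->
  exists K L : set config, [/\ @closed cantorZ K, @closed cantorZ L, K `<=` A, L `<=` ~` A &
    (mu (~` (K `|` L)) <= eps%:E)%E].

(** An open set is the increasing union of its clopen box interiors, and its complement is already
    closed. *)
Let approximable_open (U : set config) : @open cantorZ U -> approximable U.
Proof.
move=> oU eps eps0.
pose F N := box_interior N U.
have FU : \bigcup_N F N = U by exact: bigcup_box_interior.
have mF N : measurable (F N) by exact: measurable_word_event.
have mU : measurable U by exact: measurable_open.
have ndF : nondecreasing_seq F.
  move=> M N MN; apply/subsetPset => eta /asboolP h; apply/asboolP => delta /box_inj e.
  by apply: h; apply/box_inj => i iM; apply: e; lia.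
have [N] := nondecreasing_approx eps0 mF ndF; rewrite FU => hN.
exists (F N), (~` U); split=> //.
- exact: closed_word_event.
- exact: open_closedC.
- by rewrite -FU; exact: bigcup_sup.
- by rewrite setCU setCK setIC -setDE.
Qed.

(** For a countable union, the intersection of the outer sets [L n] is closed at once, whereas the
    union of the inner sets [K n] is truncated to finitely many in order to stay closed. *)
Let approximable_sigma_algebra : sigma_algebra setT approximable.
Proof.
split.
- move=> eps eps0; exists set0, setT; split.
  + exact: (@closed0 cantorZ).
  + exact: (@closedT cantorZ).
  + by [].
  + by rewrite setC0.
  + by rewrite setUT setCT measure0 lee_fin ltW.
- move=> A aA eps /aA[K [L [cK cL KA LA h]]]; exists L, K.
  by rewrite setTD setUC setCK; split.
- move=> A aA eps eps0.
  (* These errors sum to [eps / 2]; the other half pays for the truncation. *)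
  have /choice[K] n : exists K : set cantorZ, exists L : set cantorZ,
      [/\ @closed cantorZ K, @closed cantorZ L, K `<=` A n, L `<=` ~` A n &
       (mu (~` (K `|` L)) <= (eps / 2 / (2 ^ n.+1)%:R)%:E)%E].
    by apply: aA; rewrite !divr_gt0 ?ltr0n ?expn_gt0.
  move=> /choice[L] KL.
  have cK n : @closed cantorZ (K n) by have [] := KL n.
  have cL n : @closed cantorZ (L n) by have [] := KL n.
  have mK n : measurable (K n : set config) by exact: measurable_closed.
  have mL n : measurable (L n : set config) by exact: measurable_closed.
  pose C n := \big[setU/set0]_(i < n) K i.
  have cC n : @closed cantorZ (C n).
    by rewrite /C; elim/big_ind: _ => //; [exact: closed0|exact: closedU].
  have mC n : measurable (C n : set config) by exact: measurable_closed.
  have UC : \bigcup_n C n = \bigcup_n K n.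
    apply/seteqP; split=> eta [n _].
      by rewrite /C -bigcup_mkord => -[i _ Ki]; exists i.
    by move=> Kn; exists n.+1 => //; rewrite /C -bigcup_mkord; exists n => //=.
  have ndC : nondecreasing_seq (C : (set config)^nat).
    move=> m n mn; apply/subsetPset => eta; rewrite /C -!bigcup_mkord => -[i im Ki].
    by exists i => //=; apply: leq_trans mn.
  have mUC : measurable (\bigcup_n C n : set config) by exact: bigcup_measurable.
  have eps2 : 0 < eps / 2 by rewrite divr_gt0.
  have [N hN] := nondecreasing_approx eps2 (mC : forall n, measurable (C n : set config)) ndC.
  have cIL : @closed cantorZ (\bigcap_n L n) by exact: closed_bigI.
  exists (C N), (\bigcap_n L n); split=> //.
  + rewrite /C -bigcup_mkord => eta [i _ Ki]; exists i => //.
    by have [_ _ h _ _] := KL i; exact: h.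
  + move=> eta Le [i _]; have [_ _ _ h _] := KL i.
    by apply: h; exact: Le.
  have mIL : measurable (\bigcap_n L n : set config) by exact: measurable_closed.
  pose X n : set config := ~` (K n `|` L n).
  have mX n : measurable (X n) by apply: measurableC; exact: measurableU.
  have mUX : measurable (\bigcup_n X n) by exact: bigcup_measurable.
  (* A point left uncovered is either lost by the truncation or missed by some pair [K n], [L n]. *)
  have sub : ~` (C N `|` \bigcap_n L n) `<=`
      ((\bigcup_n C n) `\` C N) `|` \bigcup_n X n.
    move=> eta /= /not_orP[nC]; rewrite UC => nL.
    have [Ke|nK] := pselect ((\bigcup_n K n) eta); first by left.
    right; move: nL => /existsNP[n /not_implyP[_ nLn]]; exists n => //.
    by case=> // Kn; apply: nK; exists n.
  apply: le_trans (le_measure mu _ _ sub) _; rewrite ?inE.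
  + by apply: measurableC; exact: measurableU.
  + by apply: measurableU => //; exact: measurableD.
  apply: le_trans (measureU2 _ _ _) _ => //; first exact: measurableD.
  rewrite (splitr eps) EFinD leeD//.
  have := measure_sigma_subadditive mu mX mUX (@subset_refl _ _).
  move=> /le_trans; apply.
  apply: le_trans (epsilon_trick0 xpredT (ltW eps2)).
  by apply: lee_nneseries => // n _; have [] := KL n.
Qed.

Lemma inner_regular (A : set config) (eps : R) : measurable A -> 0 < eps ->
  exists K : set config, [/\ @closed cantorZ K, K `<=` A & (mu A <= mu K + eps%:E)%E].
Proof.
move=> mA eps0.
have : approximable A.
  by move: mA; apply: smallest_sub; [exact: approximable_sigma_algebra|
    exact: approximable_open].
move=> /(_ _ eps0)[K [L [cK cL KA LA KL]]]; exists K; split=> //.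
have mK : measurable K by exact: measurable_closed.
have mL : measurable L by exact: measurable_closed.
apply: le_trans (_ : (mu (K `|` ~` (K `|` L)) <= _)%E).
  apply: le_measure; rewrite ?inE//.
    by apply: measurableU => //; apply: measurableC; exact: measurableU.
  move=> eta Ae; have [Ke|nK] := pselect (K eta); first by left.
  by right=> -[//|/LA].
apply: le_trans (measureU2 _ _ _) _ => //.
  by apply: measurableC; exact: measurableU.
by rewrite leeD2l.
Qed.

End regularity.

(** For closed [K] inside [A], [mu K <= mu (up_box N K) <= nu (up_box N K)]. The last term decreases
    to the [nu]-measure of the intersection, which lies in [A] because [A] is increasing. *)
Lemma window_domination (R : realType) (mu nu : probability config R) (p : R) :
    0 <= p <= 1 ->
    (forall m a, p * patP nu (window (m + 1) a) <= patP nu ((m, true) :: window (m + 1) a)) ->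
    (forall m a, patP mu ((m, true) :: window (m + 1) a) <= p * patP mu (window (m + 1) a)) ->
  stoch_dominated mu nu.
Proof.
move=> p01 nup mup A mA iA; apply/lee_addgt0Pr => eps eps0.
have [K [cK KA muK]] := inner_regular mu mA eps0.
have mK : measurable K by exact: measurable_closed.
apply: le_trans muK _; rewrite leeD2r//.
have mU N : measurable (up_box N K) by exact: measurable_word_event.
have UA : \bigcap_N up_box N K `<=` A.
  move=> delta h; have [|eta Ke ed] := bigcap_up_box cK (delta := delta).
    by move=> N; exact: h.
  by apply: iA ed; exact: KA.
have mIU : measurable (\bigcap_N up_box N K) by exact: bigcapT_measurable.
apply: (@le_trans _ _ (nu (\bigcap_N up_box N K))); last first.
  by apply: le_measure; rewrite ?inE.
have niU : nonincreasing_seq (up_box ^~ K).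
  move=> M N MN; apply/subsetPset => eta /up_boxP[d Kd h]; apply/up_boxP.
  by exists d => // i iM; apply: h; lia.
have nu0 : (nu (up_box 0 K) < +oo)%E by rewrite -ge0_fin_numE ?fin_num_measure.
have /cvg_lim <- := nonincreasing_cvg_mu nu0 mU mIU niU; last by [].
apply: lime_ge.
  by apply/cvg_ex; eexists; exact: (nonincreasing_cvg_mu nu0 mU mIU niU).
apply: nearW => N /=.
apply: (@le_trans _ _ (mu (up_box N K))).
  apply: le_measure; rewrite ?inE// => eta Ke.
  by apply/up_boxP; exists eta.
apply: (word_event_domination p01 nup mup) => a b ab /asboolP[eta Ke h].
apply/asboolP; exists eta => //; move: h ab.
elim: (box N eta) a b => [|x s ih] [|y a] [|z b]//= /andP[xy /ih sa] /andP[yz /sa ->].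
by case: x y z xy yz => [] [] [].
Qed.

(** * Determinantal processes *)

Lemma det_block_schur (F : fieldType) (m n : nat) (D : 'M[F]_m) (U : 'M[F]_(m, n))
    (V : 'M[F]_(n, m)) (A : 'M[F]_n) : A \in unitmx ->
  \det (block_mx D U V A) = \det (D - U *m invmx A *m V) * \det A.
Proof.
move=> uA.
have -> : block_mx D U V A =
    block_mx (D - U *m invmx A *m V) U 0 A *m block_mx 1%:M 0 (invmx A *m V) 1%:M.
  rewrite mulmx_block !mulmx1 !mulmx0 !add0r mulmxA subrK.
  by rewrite mulKVmx.
by rewrite det_mulmx det_ublock det_lblock !det1 !mulr1.
Qed.

Lemma det_mx22 (R : comNzRingType) (M : 'M[R]_2) :
  \det M = M 0 0 * M 1 1 - M 0 1 * M 1 0.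
Proof.
rewrite (expand_det_row _ ord0) big_ord_recl big_ord1 /cofactor !det_mx11 !mxE.
have -> : lift ord0 ord0 = 1 :> 'I_2 by apply/val_inj.
have -> : lift 1 ord0 = 0 :> 'I_2 by apply/val_inj.
by rewrite expr0 expr1 mul1r mulN1r mulrN.
Qed.

Section gram.
Local Open Scope sesquilinear_scope.
Variables (C : numClosedFieldType) (k : int -> C).

(** Multilinearity in the rows of the zeros turns the inclusion-exclusion sum of minors of the
    kernel into this one determinant, up to [pattern_sign]. *)
Definition pattern_mx n (e : 'I_n -> int) (a : 'I_n -> bool) : 'M[C]_n :=
  \matrix_(i, j) (k (e j - e i) - ((i == j) && ~~ a i)%:R).

Definition pattern_sign n (a : 'I_n -> bool) : C :=
  \prod_i (if a i then 1 else -1).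

(** The matrices with value 0 and with value 1 at [i0] differ by 1 in a single diagonal entry, so
    expansion along that row makes their determinants differ by the minor without [i0]. This mirrors
    the recursion [cyl_rec] for probabilities. *)
Lemma pattern_det_rec n (e : 'I_n.+1 -> int) (a : 'I_n.+1 -> bool) (i0 : 'I_n.+1) :
  ~~ a i0 ->
  pattern_sign a * \det (pattern_mx e a) =
  pattern_sign (a \o lift i0) * \det (pattern_mx (e \o lift i0) (a \o lift i0)) -
  pattern_sign (fun i => (i == i0) || a i) *
    \det (pattern_mx e (fun i => (i == i0) || a i)).
Proof.
move=> /negPf ai0; set a' := fun i => _.
have sa : pattern_sign a = - pattern_sign (a \o lift i0).
  by rewrite /pattern_sign (bigD1_ord i0)//= ai0 mulN1r.
have sa' : pattern_sign a' = pattern_sign (a \o lift i0).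
  rewrite /pattern_sign (bigD1_ord i0)//= /a' eqxx mul1r.
  by apply: eq_bigr => i _; rewrite eq_sym (negPf (neq_lift _ _)).
have minor : row' i0 (col' i0 (pattern_mx e a)) =
    pattern_mx (e \o lift i0) (a \o lift i0).
  by apply/matrixP => i j; rewrite !mxE (inj_eq (@lift_inj _ i0)).
have cof j : cofactor (pattern_mx e a') i0 j = cofactor (pattern_mx e a) i0 j.
  rewrite /cofactor; congr (_ * \det _); apply/matrixP => i l; rewrite !mxE /a'.
  by rewrite (eq_sym _ i0) (negPf (neq_lift _ _)).
have key : \det (pattern_mx e a') - \det (pattern_mx e a) =
    \det (pattern_mx (e \o lift i0) (a \o lift i0)).
  rewrite !(expand_det_row (pattern_mx e _) i0) -sumrB (bigD1 i0)//= big1 ?addr0; last first.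
    by move=> j ji; rewrite cof !mxE eq_sym (negPf ji) subrr.
  rewrite cof -mulrBl -minor !mxE eqxx /a' ai0 eqxx/= subr0 opprB addrC subrK.
  by rewrite mul1r /cofactor -signr_odd addnn odd_double expr0 mul1r.
rewrite sa sa' -key; ring.
Qed.

Hypothesis kN : forall m, k (- m) = (k m)^*.

Definition seq_pos (s : seq (int * bool)) (i : 'I_(size s)) : int :=
  (nth (0, true) s i).1.
Definition seq_val (s : seq (int * bool)) (i : 'I_(size s)) : bool :=
  (nth (0, true) s i).2.
Definition seq_mx s := pattern_mx (seq_pos (s := s)) (seq_val (s := s)).

Lemma seq_mx_herm s : (seq_mx s) ^t* = seq_mx s.
Proof.
apply/matrixP => i j; rewrite !mxE rmorphB rmorph_nat /= -kN opprB (eq_sym j).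
by case: eqVneq => // ->.
Qed.

(* Since [k] is Hermitian, so is the Schur complement of the pattern matrix in
   the matrix with two added sites; its determinant is the product of its
   diagonal entries minus a square modulus. *)
Lemma seq_mx_pairwise (i j : int) s (u := seq_mx s) : \det u != 0 ->
  exists c : C,
  \det (seq_mx [:: (i, true), (j, true) & s]) * \det u =
  \det (seq_mx ((i, true) :: s)) * \det (seq_mx ((j, true) :: s)) -
  (c * c^*) * \det u ^+ 2.
Proof.
move=> u0; have uu : u \in unitmx by rewrite unitmxE unitfE.
pose r x : 'rV[C]_(size s) := \row_l k (seq_pos l - x).
pose v x : 'cV[C]_(size s) := \col_l k (x - seq_pos l).
have rv x : (r x)^t* = v x by apply/matrixP => a b; rewrite !mxE -kN opprB.
have vr x : (v x)^t* = r x by rewrite -rv trmxCK.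
(* Entries of the Schur complement of [u] when sites [x] and [y] are added. *)
pose S x y := k (y - x) - (r x *m invmx u *m v y) 0 0.
have uH : (invmx u)^t* = invmx u by rewrite trmx_inv map_invmx seq_mx_herm.
have SC : S j i = (S i j)^*.
  rewrite /S rmorphB /= -kN opprB; congr (_ - _).
  have -> : ((r i *m invmx u *m v j) 0 0)^* = ((r i *m invmx u *m v j)^t*) 0 0 by rewrite !mxE.
  by rewrite !trmx_mul !map_mxM/= uH rv vr mulmxA.
have one x : \det (seq_mx ((x, true) :: s)) = S x x * \det u.
  have e : seq_mx ((x, true) :: s) = block_mx (k 0)%:M (r x) (v x) u :> 'M[C]_(1 + size s).
    apply/matrixP => a b; rewrite !mxE.
    case: splitP => a' ea; rewrite !mxE; case: splitP => b' eb; rewrite !mxE.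
    - by rewrite /seq_pos /seq_val ea eb !ord1 /= subrr andbF subr0 mulr1n.
    - rewrite /seq_pos ea eb !ord1 /= -val_eqE /= ea eb !ord1 /=.
      by rewrite subr0.
    - rewrite /seq_pos ea eb !ord1 /= -val_eqE /= ea eb !ord1 /=.
      by rewrite subr0.
    - by rewrite /seq_pos /seq_val ea eb /= -!val_eqE /= ea eb.
  transitivity (\det (block_mx (k 0)%:M (r x) (v x) u)).
    exact: (congr1 (@determinant C (1 + size s)) e).
  rewrite det_block_schur// det_mx11; congr (_ * _).
  by rewrite !mxE eqxx mulr1n /S subrr !mxE.
have two : \det (seq_mx [:: (i, true), (j, true) & s]) =
    (S i i * S j j - S i j * S j i) * \det u.
  pose x (a : 'I_2) := if a == 0 then i else j.
  have e : seq_mx [:: (i, true), (j, true) & s] =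
      block_mx (\matrix_(a, b) k (x b - x a))
        (\matrix_(a, l) k (seq_pos l - x a)) (\matrix_(l, a) k (x a - seq_pos l)) u
      :> 'M[C]_(2 + size s).
    have px (a : 'I_(size s).+2) (a' : 'I_2) : a = a' :> nat ->
        seq_pos (s := [:: (i, true), (j, true) & s]) a = x a' /\
        seq_val (s := [:: (i, true), (j, true) & s]) a.
      by rewrite /seq_pos /seq_val => ->; case: a' => [[|[|]]].
    apply/matrixP => a b; rewrite !mxE.
    case: splitP => a' ea; rewrite !mxE; case: splitP => b' eb; rewrite !mxE.
    - by have [-> ->] := px _ _ ea; have [-> _] := px _ _ eb; rewrite andbF subr0.
    - have [-> ->] := px _ _ ea; rewrite andbF subr0.
      by rewrite /seq_pos eb.
    - have [-> _] := px _ _ eb; rewrite -val_eqE /= ea eb.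
      rewrite (_ : (_ == _) = false) ?subr0 ?/seq_pos ?ea//.
      by apply/eqP; case: b' {eb} => /= b'; lia.
    - by rewrite /seq_pos /seq_val ea eb /= -!val_eqE /= ea eb.
  etransitivity; first exact: (congr1 (@determinant C (2 + size s)) e).
  rewrite det_block_schur// det_mx22; congr (_ * _).
  have E a b : (\matrix_(a, b) k (x b - x a) - \matrix_(a, l) k (seq_pos l - x a) *m
      invmx u *m \matrix_(l, a) k (x a - seq_pos l)) a b = S (x a) (x b).
    rewrite /S !mxE; congr (_ - _); apply: eq_bigr => l _; rewrite !mxE.
    by congr (_ * _); apply: eq_bigr => l' _; rewrite !mxE.
  by rewrite !E.
exists (S i j); rewrite two !one -SC; ring.
Qed.
End gram.

(** * Pattern probabilities of a determinantal process *)

Definition cyl n (e : 'I_n -> int) (a : 'I_n -> bool) : set config :=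
  [set eta : config | forall i, eta (e i) = a i].

Lemma measurable_cyl n (e : 'I_n -> int) a : measurable (cyl e a).
Proof.
rewrite (_ : cyl e a = \bigcap_i [set eta : config | eta (e i) = a i]); last first.
  by apply/seteqP; split=> eta h i; [move=> _; exact: h|exact: (h i I)].
by apply: fin_bigcap_measurable => // i _; exact: measurable_coord.
Qed.

Lemma pat_cyl s : pat s = cyl (seq_pos (s := s)) (seq_val (s := s)).
Proof.
apply/seteqP; split=> eta.
  by move/(all_nthP (0, true)) => h i; apply/eqP; exact: h.
by move=> h; apply/(all_nthP (0, true)) => i si; rewrite (h (Ordinal si)).
Qed.

Lemma seq_pos_inj s : uniq (map fst s) -> injective (seq_pos (s := s)).
Proof.
move=> us i j; rewrite /seq_pos -!(nth_map _ 0)// => /eqP.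
by rewrite nth_uniq ?size_map// => /eqP/val_inj.
Qed.

Lemma cyl_rec n (e : 'I_n.+1 -> int) (a : 'I_n.+1 -> bool) (i0 : 'I_n.+1)
    (R : realType) (P : probability config R) : ~~ a i0 ->
  fine (P (cyl e a)) = fine (P (cyl (e \o lift i0) (a \o lift i0))) -
    fine (P (cyl e (fun i => (i == i0) || a i))).
Proof.
move=> /negPf ai0; apply/eqP; rewrite eq_sym subr_eq; apply/eqP.
have m n' (e' : 'I_n' -> int) a' := measurable_cyl e' a'.
rewrite -fineD ?fin_num_measure// -measureU//; last first.
  apply/seteqP; split=> // eta [/(_ i0) + /(_ i0)]; rewrite eqxx /= ai0 => ->//.
congr (fine (P _)); apply/seteqP; split=> eta.
  move=> h; case e0 : (eta (e i0)); [right|left] => i;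
    have [i1 ->|->] := unliftP i0 i; rewrite ?e0 ?eqxx ?ai0//.
    by rewrite [lift _ _ == _]eq_sym (negPf (neq_lift _ _)); exact: (h i1).
  exact: (h i1).
move=> [] h i /=; rewrite h//.
by rewrite [lift _ _ == _]eq_sym (negPf (neq_lift _ _)).
Qed.

Lemma patP_shift_cyl (R : realType) (P : probability config R) c s :
  patP P (shift_pat c s) = fine (P (cyl (fun i => seq_pos (s := s) i + c) (seq_val (s := s)))).
Proof.
rewrite /patP; congr (fine (P _)); rewrite /pat /shift_pat; apply/seteqP; split=> eta /=.
  rewrite all_map => /(all_nthP (0, true)) h i; apply/eqP; exact: h.
by move=> h; rewrite all_map; apply/(all_nthP (0, true)) => i si /=; rewrite (h (Ordinal si)).
Qed.

Section determinantal_process.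
Variables (R : realType) (k : int -> R[i]) (P : probability config R).
Hypothesis kN : forall m, k (- m) = (k m)^*.
Hypothesis Pdet : forall n (e : 'I_n -> int), (0 < n)%N -> injective e ->
  (fine (P (cyl e (fun=> true))))%:C%C = \det (\matrix_(i, j) k (e j - e i)).

(** Induction on the number of zeros: patterns of ones are the determinantal property, and [cyl_rec]
    and [pattern_det_rec] remove a zero in the same way on both sides. *)
Lemma cyl_det n (e : 'I_n -> int) (a : 'I_n -> bool) : injective e ->
  (fine (P (cyl e a)))%:C%C = pattern_sign _ a * \det (pattern_mx k e a).
Proof.
have [m] := ubnP #|[set i | ~~ a i]%SET|; elim: m => // m ih in n e a *.
move=> am ie; have [a1|/forallPn[i0 ai0]] := boolP [forall i, a i].
  have -> : a = fun=> true by apply/funext => i; have /forallP-> := a1.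
  rewrite /pattern_sign big1 ?mul1r//.
  have -> : pattern_mx k e (fun=> true) = \matrix_(i, j) k (e j - e i).
    by apply/matrixP => i j; rewrite !mxE andbF subr0.
  (* The determinantal property is given for nonempty tuples; the empty pattern has probability 1,
     as has the empty determinant. *)
  case: n e {am ie a a1} (ie) => [|n] e ie; last exact: Pdet.
  rewrite (_ : cyl _ _ = setT) ?probability_setT ?det_mx00//.
  by apply/seteqP; split=> // eta _ [].
case: n e a i0 am ie ai0 => [|n] e a i0 am ie ai0; first by have := ltn_ord i0.
rewrite (cyl_rec _ _ ai0) rmorphB/= (pattern_det_rec _ _ ai0) !ih//.
- apply: leq_trans (_ : (#|[set i | ~~ a i]%SET| <= m)%N) => //.
  rewrite [X in (_ < X)%N](cardsD1 i0) inE ai0 ltnS subset_leq_card//.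
  by apply/fintype.subsetP => i; rewrite !inE negb_or => /andP[-> ->].
- rewrite -(card_imset _ (@lift_inj _ i0)).
  apply: leq_trans (_ : (#|[set i | ~~ a i]%SET| <= m)%N) => //.
  rewrite [X in (_ < X)%N](cardsD1 i0) inE ai0 ltnS subset_leq_card//.
  apply/fintype.subsetP => i; case/imsetP => j; rewrite !inE => aj ->.
  by rewrite aj eq_sym neq_lift.
- by apply: inj_comp ie _; exact: lift_inj.
Qed.

Lemma determinantal_shift c s : uniq (map fst s) ->
  patP P (shift_pat c s) = patP P s.
Proof.
move=> us; have ip := seq_pos_inj us.
rewrite patP_shift_cyl /patP pat_cyl.
apply: complexI; rewrite (cyl_det _ ip).
rewrite cyl_det; last by move=> i j /addIr/ip.
congr (_ * \det _); apply/matrixP => i j; rewrite !mxE.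
by rewrite opprD addrACA subrr addr0.
Qed.

Lemma determinantal_pnc : pairwise_cond_neg_corr P.
Proof.
move=> i j s us.
have us' : uniq (map fst s) by case/and3P: us.
have ui : uniq (map fst ((i, true) :: s)).
  by move: us; rewrite /= inE negb_or => /and3P[/andP[_ ->]].
have uj : uniq (map fst ((j, true) :: s)) by case/andP: us.
(* The added sites carry ones, so all four patterns have the same sign, which cancels in the
   products. *)
pose sg := pattern_sign R[i] (seq_val (s := s)).
have sgsg : sg * sg = 1.
  rewrite /sg /pattern_sign -big_split/= big1// => l _.
  by case: ifP; rewrite ?mulr1// mulrNN mulr1.
have E t : uniq (map fst t) -> (patP P t)%:C%C = pattern_sign _ (seq_val (s := t)) * \det (seq_mx k t).
  by move=> ut; rewrite /patP pat_cyl cyl_det//; exact: seq_pos_inj.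
have sg1 x t : pattern_sign R[i] (seq_val (s := (x, true) :: t)) = pattern_sign _ (seq_val (s := t)).
  by rewrite /pattern_sign big_ord_recl mul1r; apply: eq_bigr => l _.
(* A singular pattern matrix has no Schur complement, but then [s] has probability 0 and the left
   side vanishes. *)
have [d0|d0] := eqVneq (\det (seq_mx k s)) 0.
  have -> : patP P s = 0 by apply: complexI; rewrite E// d0 mulr0.
  by rewrite mulr0 mulr_ge0 ?patP_ge0.
rewrite -lecR !rmorphM /= !E// !sg1 -/sg.
have [c hc] := seq_mx_pairwise kN i j d0.
rewrite mulrACA hc [leRHS]mulrACA sgsg !mul1r lerBlDr lerDl.
have -> : c * c^* * \det (seq_mx k s) ^+ 2 = (c * c^*) * ((patP P s) ^+ 2)%:C%C.
  by rewrite rmorphXn/= E// -/sg exprMn (expr2 sg) sgsg mul1r.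
by rewrite mulr_ge0 ?mul_conjC_ge0// ler0c sqr_ge0.
Qed.

Lemma determinantal_ones n : (patP P (ones 1 n))%:C%C =
  \det (\matrix_(i < n, j < n) k (j%:Z - i%:Z)).
Proof.
have -> : patP P (ones 1 n) = fine (P (cyl (fun i : 'I_n => 1 + i%:Z) (fun=> true))).
  rewrite /patP; congr (fine (P _)); rewrite /pat /ones; apply/seteqP; split=> eta /=.
    rewrite all_map => /allP h i; apply/eqP.
    by apply: (h (i : nat)); rewrite mem_iota /= add0n.
  move=> h; rewrite all_map; apply/allP => i; rewrite mem_iota /= => ni.
  by have := h (Ordinal ni) => /= ->.
rewrite cyl_det; last by move=> i j ij; apply/val_inj => /=; lia.
rewrite /pattern_sign big1 // mul1r.
congr (\det _); apply/matrixP => i j.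
by rewrite !mxE andbF subr0 opprD addrACA subrr add0r.
Qed.

End determinantal_process.

(** * Fourier series of bounded functions *)

Section integral.
Variable R : realType.
Implicit Types f g : R -> R.
Local Notation mu := (@lebesgue_measure R).
Local Notation I01 := (`[0 : R, 1[%classic).

(** A class stable under sums and products whose members are all integrable over a period, so that
    integrability need not be tracked separately. *)
Definition bmeas f := measurable_fun setT f /\ exists M, forall x, `|f x| <= M.

Definition int01 f : R := \int[mu]_(x in I01) f x.

Lemma bmeas_cst (c : R) : bmeas (fun=> c).
Proof. by split; [exact: measurable_cst|exists `|c|]. Qed.

Lemma bmeasD f g : bmeas f -> bmeas g -> bmeas (fun x => f x + g x).
Proof.
move=> [mf [M fM]] [mg [N gN]]; split; first exact: measurable_funD.
by exists (M + N) => x; apply: le_trans (ler_normD _ _) _; exact: lerD.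
Qed.

Lemma bmeasM f g : bmeas f -> bmeas g -> bmeas (fun x => f x * g x).
Proof.
move=> [mf [M fM]] [mg [N gN]]; split; first exact: measurable_funM.
by exists (M * N) => x; rewrite normrM ler_pM.
Qed.

Lemma bmeasN f : bmeas f -> bmeas (fun x => - f x).
Proof.
move=> [mf [M fM]]; split; first exact: measurableT_comp.
by exists M => x; rewrite normrN.
Qed.

Lemma bmeasB f g : bmeas f -> bmeas g -> bmeas (fun x => f x - g x).
Proof. by move=> bf bg; apply: bmeasD => //; exact: bmeasN. Qed.

Lemma bmeas_sum n (F : 'I_n -> R -> R) :
  (forall i, bmeas (F i)) -> bmeas (fun x => \sum_i F i x).
Proof.
move=> bF; rewrite (_ : (fun x => _) = \sum_i F i); last by apply/funext => x; rewrite fct_sumE.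
elim/big_ind: _ => //; [exact: bmeas_cst|move=> f g; exact: bmeasD].
Qed.

Lemma continuous_bmeas f (M : R) : continuous f -> (forall x, `|f x| <= M) -> bmeas f.
Proof.
by move=> cf fM; split; [exact: continuous_measurable_fun|exists M].
Qed.

Lemma bmeas_norm f : bmeas f -> bmeas (fun x => `|f x|).
Proof.
move=> [mf [M fM]]; split; first exact: measurableT_comp.
by exists M => x; rewrite normr_id.
Qed.

Lemma lebesgue_I01 : mu I01 = 1%E.
Proof. by rewrite lebesgue_measure_itv/= lte01 oppr0 adde0. Qed.

Lemma bmeas_integrable f : bmeas f -> mu.-integrable I01 (EFin \o f).
Proof.
move=> [mf [M fM]]; apply: measurable_bounded_integrable => //.
- by rewrite [ltLHS]lebesgue_I01 ltry.
- exact: measurable_funTS.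
- by exists M; split=> [|N MN x _]; [exact: num_real|exact: le_trans (fM x) (ltW MN)].
Qed.

Lemma int01_cst c : int01 (fun=> c) = c.
Proof. by rewrite /int01 Rintegral_cst// [X in fine X]lebesgue_I01 mulr1. Qed.

Lemma int01D f g : bmeas f -> bmeas g ->
  int01 (fun x => f x + g x) = int01 f + int01 g.
Proof. by move=> bf bg; rewrite /int01 RintegralD//; exact: bmeas_integrable. Qed.

Lemma int01B f g : bmeas f -> bmeas g ->
  int01 (fun x => f x - g x) = int01 f - int01 g.
Proof. by move=> bf bg; rewrite /int01 RintegralB//; exact: bmeas_integrable. Qed.

Lemma int01Z c f : bmeas f -> int01 (fun x => c * f x) = c * int01 f.
Proof. by move=> bf; rewrite /int01 RintegralZl//; exact: bmeas_integrable. Qed.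

Lemma int01N f : bmeas f -> int01 (fun x => - f x) = - int01 f.
Proof.
move=> bf; rewrite -mulN1r -int01Z//; congr int01.
by apply/funext => x; rewrite mulN1r.
Qed.

Lemma int01_sum n (F : 'I_n -> R -> R) : (forall i, bmeas (F i)) ->
  int01 (fun x => \sum_i F i x) = \sum_i int01 (F i).
Proof.
elim: n F => [|n ih] F bF.
  rewrite big_ord0 -[RHS](int01_cst 0); congr int01.
  by apply/funext => x; rewrite big_ord0.
rewrite big_ord_recl -ih// -int01D//; last exact: bmeas_sum.
by congr int01; apply/funext => x; rewrite big_ord_recl.
Qed.

Lemma le_int01 f g : bmeas f -> bmeas g -> (forall x, 0 <= x < 1 -> f x <= g x) ->
  int01 f <= int01 g.
Proof.
move=> bf bg fg; apply: le_Rintegral => //; exact: bmeas_integrable.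
Qed.

Lemma int01_ge0 f : bmeas f -> (forall x, 0 <= x < 1 -> 0 <= f x) -> 0 <= int01 f.
Proof.
move=> bf f0; rewrite -(int01_cst 0); apply: le_int01 => //; exact: bmeas_cst.
Qed.

Lemma ler_norm_int01 f : bmeas f -> `|int01 f| <= int01 (fun x => `|f x|).
Proof. by move=> bf; apply: le_normr_Rintegral => //; exact: bmeas_integrable. Qed.

(** Bounded convergence, with assumptions on the open interval only, where [fejer_cvg] gives
    convergence; the endpoint 0 is a null set. *)
Lemma dominated_int01 (F : nat -> R -> R) f (M : R) :
  (forall n, bmeas (F n)) -> bmeas f -> (forall n x, 0 < x < 1 -> `|F n x| <= M) ->
  (forall x, 0 < x < 1 -> F n x @[n --> \oo] --> f x) ->
  int01 (F n) @[n --> \oo] --> int01 f.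
Proof.
move=> bF bf FM Ff.
have N0 : mu.-negligible [set 0 : R].
  by exists [set 0]; split=> //; exact: lebesgue_measure_set1.
have ae (Q : R -> Prop) : (forall x, 0 < x < 1 -> Q x) -> {ae mu, forall x, I01 x -> Q x}.
  move=> hQ; apply: negligibleS N0 => x /= /not_implyP[]; rewrite in_itv/= => /andP[x0 x1] nQ.
  by apply/eqP; apply: contra_notT nQ => xn; apply: hQ; rewrite x1 andbT lt_neqAle eq_sym xn.
have [|||||_ _] := @dominated_convergence _ _ R mu I01 (measurable_itv _)
  (fun n => EFin \o F n) (EFin \o f) (EFin \o cst M).
- by move=> n; apply/measurable_EFinP; apply: measurable_funTS; case: (bF n).
- by apply/measurable_EFinP; apply: measurable_funTS; case: bf.
- by apply: ae => x x01; apply: cvg_EFin; [exact: nearW|exact: Ff].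
- by apply: bmeas_integrable; exact: bmeas_cst.
- have [N [mN Nn sN]] := ae (fun x => forall n, (`|(F n x)%:E| <= M%:E)%E) (fun x x01 n => FM n x x01).
  exists N; split=> // x nh; apply: sN => /= h; apply: nh => n Ix; exact: h.
have fin g : bmeas g -> (\int[mu]_(x in I01) (g x)%:E)%E \is a fin_num.
  by move=> /bmeas_integrable bg; exact: integrable_fin_num.
move=> h; rewrite -(fineK (fin _ bf)) in h; by move/fine_cvgP : h => [_].
Qed.



End integral.

(** * Characters and Fourier coefficients *)

Section fourier.
Local Open Scope complex_scope.
Variable R : realType.
Implicit Types (f : R -> R) (g : R -> R[i]).
Local Notation C := R[i].
Local Notation Re := (@complex.Re R).
Local Notation Im := (@complex.Im R).

Definition cbmeas g := bmeas (Re \o g) /\ bmeas (Im \o g).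

Local Notation IC := (@torus_integralC R).

Lemma torus_integralCE g : IC g = int01 (Re \o g) +i* int01 (Im \o g).
Proof. by []. Qed.

Lemma cbmeasD g h : cbmeas g -> cbmeas h -> cbmeas (fun x => g x + h x).
Proof.
move=> [g1 g2] [h1 h2]; split.
  rewrite (_ : _ \o _ = fun x => Re (g x) + Re (h x)); first exact: bmeasD.
  by apply/funext => x /=; case: (g x) (h x) => [? ?] [].
rewrite (_ : _ \o _ = fun x => Im (g x) + Im (h x)); first exact: bmeasD.
by apply/funext => x /=; case: (g x) (h x) => [? ?] [].
Qed.

Lemma cbmeasM g h : cbmeas g -> cbmeas h -> cbmeas (fun x => g x * h x).
Proof.
move=> [g1 g2] [h1 h2]; split.
  rewrite (_ : _ \o _ = fun x => Re (g x) * Re (h x) - Im (g x) * Im (h x)).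
    by apply: bmeasB; exact: bmeasM.
  by apply/funext => x /=; case: (g x) (h x) => [? ?] [].
rewrite (_ : _ \o _ = fun x => Re (g x) * Im (h x) + Im (g x) * Re (h x)).
  by apply: bmeasD; exact: bmeasM.
by apply/funext => x /=; case: (g x) (h x) => [? ?] [].
Qed.

Lemma cbmeas_cst (c : C) : cbmeas (fun=> c).
Proof. by split; exact: bmeas_cst. Qed.

Lemma cbmeas_real f : bmeas f -> cbmeas (fun x => (f x)%:C).
Proof. by move=> bf; split => //; exact: bmeas_cst. Qed.

Lemma cbmeas_sum n (G : 'I_n -> R -> C) :
  (forall i, cbmeas (G i)) -> cbmeas (fun x => \sum_i G i x).
Proof.
move=> bG; rewrite (_ : (fun x => _) = \sum_i G i); last by apply/funext => x; rewrite fct_sumE.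
elim/big_ind: _ => //; [exact: cbmeas_cst|move=> f g; exact: cbmeasD].
Qed.

Lemma torus_integralCD g h : cbmeas g -> cbmeas h ->
  IC (fun x => g x + h x) = IC g + IC h.
Proof.
move=> [g1 g2] [h1 h2]; rewrite !torus_integralCE.
have -> : Re \o (fun x => g x + h x) = fun x => (Re \o g) x + (Re \o h) x.
  by apply/funext => x /=; case: (g x) (h x) => [? ?] [].
have -> : Im \o (fun x => g x + h x) = fun x => (Im \o g) x + (Im \o h) x.
  by apply/funext => x /=; case: (g x) (h x) => [? ?] [].
by rewrite !int01D.
Qed.

Lemma torus_integralCZ (c : C) g : cbmeas g -> IC (fun x => c * g x) = c * IC g.
Proof.
move=> [g1 g2]; rewrite !torus_integralCE; case: c => a b.
have -> : Re \o (fun x => (a +i* b) * g x) = fun x => a * (Re \o g) x - b * (Im \o g) x.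
  by apply/funext => x /=; case: (g x).
have -> : Im \o (fun x => (a +i* b) * g x) = fun x => a * (Im \o g) x + b * (Re \o g) x.
  by apply/funext => x /=; case: (g x).
have bZ d u : bmeas u -> bmeas (fun x => d * u x) by apply: bmeasM; exact: bmeas_cst.
by rewrite int01B ?int01D ?int01Z//; exact: bZ.
Qed.

Lemma torus_integralC_sum n (G : 'I_n -> R -> C) : (forall i, cbmeas (G i)) ->
  IC (fun x => \sum_i G i x) = \sum_i IC (G i).
Proof.
elim: n G => [|n ih] G bG.
  rewrite big_ord0 torus_integralCE.
  have -> : Re \o (fun x => \sum_(i < 0) G i x) = fun=> 0.
    by apply/funext => x; rewrite /= big_ord0.
  have -> : Im \o (fun x => \sum_(i < 0) G i x) = fun=> 0.
    by apply/funext => x; rewrite /= big_ord0.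
  by rewrite int01_cst.
rewrite big_ord_recl -ih// -torus_integralCD//; last exact: cbmeas_sum.
by congr IC; apply/funext => x; rewrite big_ord_recl.
Qed.

Lemma torus_integralC_real f : IC (fun x => (f x)%:C) = (int01 f)%:C.
Proof. by rewrite torus_integralCE (_ : Im \o _ = fun=> 0) ?int01_cst. Qed.

Lemma torus_integralC_conj g : cbmeas g -> IC (fun x => conjc (g x)) = conjc (IC g).
Proof.
move=> [g1 g2]; rewrite !torus_integralCE.
have -> : Re \o (fun x => conjc (g x)) = Re \o g by apply/funext => x /=; case: (g x).
have -> : Im \o (fun x => conjc (g x)) = fun x => - (Im \o g) x.
  by apply/funext => x /=; case: (g x).
by rewrite int01N.
Qed.

(** The character [exp (2 pi i k x)] of the torus. *)
Definition ek (k : int) (x : R) : C := cis (2 * pi * k%:~R * x).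

Lemma cisD (a b : R) : cis (a + b) = cis a * cis b.
Proof. by rewrite /cis cosD sinD; congr Complex; rewrite addrC [X in _ + X]mulrC. Qed.

Lemma cisN (a : R) : cis (- a) = conjc (cis a).
Proof. by rewrite /cis cosN sinN. Qed.

Lemma ekD k l x : ek (k + l) x = ek k x * ek l x.
Proof. by rewrite /ek -cisD rmorphD/=; congr cis; ring. Qed.

Lemma ekN k x : ek (- k) x = conjc (ek k x).
Proof. by rewrite /ek -cisN rmorphN/=; congr cis; ring. Qed.

Lemma ek0 x : ek 0 x = 1.
Proof. by rewrite /ek mulr0 mul0r /cis cos0 sin0. Qed.

Lemma ek_conj k x : ek k x * conjc (ek k x) = 1.
Proof. by rewrite -ekN -ekD subrr ek0. Qed.

Lemma cbmeas_ek k : cbmeas (ek k).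
Proof.
have cl : continuous (fun x : R => 2 * pi * k%:~R * x) by exact: mulrl_continuous.
split; apply: (@continuous_bmeas _ _ 1) => x /=.
- by apply: continuous_comp; [exact: cl|exact: continuous_cos].
- by rewrite ler_norml cos_geN1 cos_le1.
- by apply: continuous_comp; [exact: cl|exact: continuous_sin].
- by rewrite ler_norml sin_geN1 sin_le1.
Qed.

Lemma fourier_coefE f k : fourier_coef f k = IC (fun x => (f x)%:C * ek (- k) x).
Proof.
rewrite /fourier_coef; congr IC; apply/funext => x; rewrite /ek rmorphN/=.
by congr (_ * cis _); ring.
Qed.

Lemma fourier_coefN f k : bmeas f -> fourier_coef f (- k) = conjc (fourier_coef f k).
Proof.
move=> bf; rewrite !fourier_coefE -torus_integralC_conj; last first.
  by apply: cbmeasM; [exact: cbmeas_real|exact: cbmeas_ek].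
congr IC; apply/funext => x; rewrite [RHS]rmorphM [ek (- - k) x]ekN; congr (_ * _).
by rewrite /= oppr0.
Qed.

Lemma int01_derive (F f : R -> R) (M : R) : continuous f -> (forall x, `|f x| <= M) ->
  (forall x : R, is_derive x (1 : R) F (f x)) -> int01 f = F 1 - F 0.
Proof.
move=> cf fM dF; have bf : bmeas f by exact: continuous_bmeas fM.
rewrite /int01 Rintegral_itv_bndo_bndc; last exact: bmeas_integrable.
rewrite /Rintegral (@continuous_FTC2 _ f F)//.
- exact: continuous_subspaceT.
- have cF x : {for x, continuous F}.
    by apply: differentiable_continuous; apply/derivable1_diffP; have [] := dF x.
  split.
  + by move=> x _; have [] := dF x.
  + exact: cvg_at_right_filter (cF 0).
  + exact: cvg_at_left_filter (cF 1).
- by move=> x _; rewrite derive1E; exact: derive_val.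
Qed.

(** Orthogonality of the characters: for [k != 0] the real and imaginary parts of [ek (- k)] have
    1-periodic primitives, so they integrate to 0 over a period. *)
Lemma fourier_coef1 k : @fourier_coef R (fun=> 1) k = (k == 0)%:R.
Proof.
rewrite fourier_coefE.
have -> : (fun x : R => (1 : R)%:C * ek (- k) x) = ek (- k).
  by apply/funext => x; rewrite mul1r.
have [->|k0] := eqVneq k 0.
  rewrite oppr0 (_ : ek 0 = fun x => (1 : R)%:C); last by apply/funext => x; rewrite ek0.
  by rewrite torus_integralC_real int01_cst.
pose c : R := 2 * pi * (- k)%:~R.
have c0 : c != 0.
  apply: mulf_neq0; last by rewrite intr_eq0 oppr_eq0.
  by apply: mulf_neq0; rewrite ?pnatr_eq0// gt_eqF ?pi_gt0.
have cl : continuous (fun x : R => c * x) by exact: mulrl_continuous.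
have e : cis c = 1.
  have cisp (m : nat) : cis (2 * pi * m%:R : R) = 1.
    elim: m => [|m ih]; first by rewrite mulr0 /cis cos0 sin0.
    rewrite -[m.+1%:R]natr1 mulrDr mulr1 cisD ih mul1r /cis.
    by rewrite (mulr_natl pi 2) cos2pi sin2pi.
  rewrite /c; case: (- k) => m; first exact: cisp.
  by rewrite NegzE rmorphN/= mulrN cisN cisp conjc1.
have [c1 s1] : cos c = 1 /\ sin c = 0 by case: e.
have dl x : is_derive x (1 : R) (fun x : R => c * x) c.
  by apply: is_derive_eq; rewrite /GRing.scale/= mulr1.
have dS x : is_derive x (1 : R) (fun x => c^-1 * sin (c * x)) (cos (c * x)).
  have h : is_derive x (1 : R) (sin \o (fun x : R => c * x)) (cos (c * x) * c).
    exact: is_derive1_comp.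
  have := is_deriveZ c^-1 h; rewrite (_ : c^-1 *: _ = cos (c * x))//.
  by rewrite /GRing.scale/= mulrCA mulVf ?mulr1.
have dC x : is_derive x (1 : R) (fun x => - (c^-1 * cos (c * x))) (sin (c * x)).
  have h : is_derive x (1 : R) (cos \o (fun x : R => c * x)) (- sin (c * x) * c).
    exact: is_derive1_comp.
  have := is_deriveN (is_deriveZ c^-1 h); rewrite (_ : - (c^-1 *: _) = sin (c * x))//.
  by rewrite /GRing.scale/= mulrCA mulVf ?mulr1 ?opprK.
have csin : continuous (fun x : R => sin (c * x)).
  by move=> x; apply: continuous_comp; [exact: cl|exact: continuous_sin].
have ccos : continuous (fun x : R => cos (c * x)).
  by move=> x; apply: continuous_comp; [exact: cl|exact: continuous_cos].
rewrite torus_integralCE.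
have -> : int01 (Re \o ek (- k)) = 0.
  rewrite (int01_derive ccos (fun x => cos_max _) dS).
  by rewrite mulr1 mulr0 s1 sin0 mulr0 subrr.
have -> : int01 (Im \o ek (- k)) = 0.
  rewrite (int01_derive csin (fun x => sin_max _) dC).
  by rewrite mulr1 mulr0 c1 cos0 subrr.
by [].
Qed.

End fourier.

(** * Toeplitz matrices and Szego's limit theorem *)

Section toeplitz.
Local Open Scope sesquilinear_scope.
Local Open Scope complex_scope.
Variable R : realType.
Implicit Types f h : R -> R.
Local Notation C := R[i].
Local Notation Re := (@complex.Re R).
Local Notation Im := (@complex.Im R).

Definition toeplitz f n : 'M[C]_n :=
  \matrix_(i, j) fourier_coef f (j%:Z - i%:Z).

Definition trig n (v : 'rV[C]_n) (x : R) : C := \sum_i v 0 i * ek i%:Z x.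

(** The squared modulus, with real values so that it can serve as a density. *)
Definition nsq (z : C) : R := Re z ^+ 2 + Im z ^+ 2.

Definition trig2 n (v : 'rV[C]_n) (x : R) : R := nsq (trig v x).

Lemma nsq_ge0 z : 0 <= nsq z.
Proof. by rewrite addr_ge0 ?sqr_ge0. Qed.

Lemma nsqE z : (nsq z)%:C = z * conjc z.
Proof. by rewrite /nsq; case: z => a b; congr Complex; rewrite /=; ring. Qed.

Lemma nsqM y z : nsq (y * z) = nsq y * nsq z.
Proof. by apply: complexI; rewrite rmorphM/= !nsqE rmorphM/=; ring. Qed.

Lemma nsq_conj z : nsq (conjc z) = nsq z.
Proof. by rewrite /nsq; case: z => a b /=; rewrite sqrrN. Qed.

Lemma nsq_le2 y z : nsq (y - z) <= 2 * (nsq y + nsq z).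
Proof.
rewrite /nsq; case: y z => [a b] [c d] /=.
by have := sqr_ge0 (a + c); have := sqr_ge0 (b + d); nra.
Qed.

Lemma nsq_ek k x : nsq (ek k x) = 1.
Proof. by apply: complexI; rewrite nsqE ek_conj. Qed.

Lemma cbmeas_trig n (v : 'rV[C]_n) : cbmeas (trig v).
Proof.
apply: cbmeas_sum => i; apply: cbmeasM; [exact: cbmeas_cst|exact: cbmeas_ek].
Qed.

Lemma bmeas_trig2 n (v : 'rV[C]_n) : bmeas (trig2 v).
Proof.
have [b1 b2] := cbmeas_trig v.
by apply: bmeasD; rewrite /GRing.exp/=; exact: bmeasM.
Qed.

Lemma trig2_ge0 n (v : 'rV[C]_n) x : 0 <= trig2 v x.
Proof. exact: nsq_ge0. Qed.

(** Expanding [trig2 v] into products of characters leaves the terms [v_i conj(v_j) ek (i - j)],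
    whose integrals against [f] are the Toeplitz entries. *)
Lemma toeplitz_quad n f (v : 'rV[C]_n) : bmeas f ->
  (v *m toeplitz f n *m v ^t*) 0 0 = (int01 (fun x => f x * trig2 v x))%:C.
Proof.
move=> bf; rewrite -torus_integralC_real.
have bfe k : cbmeas (fun x => (f x)%:C * ek k x).
  by apply: cbmeasM; [exact: cbmeas_real|exact: cbmeas_ek].
have bc c k : cbmeas (fun x => c * ((f x)%:C * ek k x)).
  by apply: cbmeasM => //; exact: cbmeas_cst.
have -> : (fun x => (f x * trig2 v x)%:C) = fun x =>
    \sum_i \sum_j (v 0 i * conjc (v 0 j)) * ((f x)%:C * ek (- (j%:Z - i%:Z)) x).
  apply/funext => x; rewrite rmorphM/= nsqE.
  have -> : conjc (trig v x) = \sum_j conjc (v 0 j * ek j%:Z x) by exact: rmorph_sum.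
  rewrite /trig big_distrlr /= mulr_sumr; apply: eq_bigr => i _.
  rewrite mulr_sumr; apply: eq_bigr => j _.
  have -> : conjc (v 0 j * ek j%:Z x) = conjc (v 0 j) * conjc (ek j%:Z x) by exact: rmorphM.
  by rewrite opprB ekD ekN; ring.
rewrite torus_integralC_sum; last by move=> i; exact: cbmeas_sum.
rewrite !mxE; under eq_bigr => j _ do rewrite !mxE mulr_suml.
rewrite exchange_big; apply: eq_bigr => i _.
rewrite torus_integralC_sum//; apply: eq_bigr => j _.
rewrite torus_integralCZ// -fourier_coefE !mxE.
by rewrite mulrAC.
Qed.

Lemma toeplitz1 n : toeplitz (fun=> 1) n = 1%:M.
Proof. by apply/matrixP => i j; rewrite !mxE fourier_coef1 subr_eq0 eq_sym. Qed.

Lemma toeplitz_herm n f : bmeas f -> (toeplitz f n)^t* = toeplitz f n.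
Proof.
move=> bf; apply/matrixP => i j; rewrite !mxE.
by rewrite -[LHS]/(conjc _) -fourier_coefN// opprB.
Qed.

(** Conjugated so that [trig2 (evec n x) y] is [n] times the Fejer kernel at [y - x]. *)
Definition evec n (x : R) : 'rV[C]_n := \row_i conjc (ek i%:Z x).

Lemma evec_norm n x : evec n x *m (evec n x)^t* = n%:R%:M.
Proof.
apply/matrixP => i j; rewrite !ord1 !mxE eqxx mulr1n.
under eq_bigr => k _.
  rewrite !mxE -[X in _ * X]/(conjc _) conjcK mulrC ek_conj; over.
by rewrite sumr_const card_ord.
Qed.

(** The Fejer mean of [f] at [x], not divided by the total mass [n] of the kernel. *)
Definition cesaro f n (x : R) : R := int01 (fun y => f y * trig2 (evec n x) y).

(* [v] is an orthonormal eigenbasis; its vectors are read as trigonometric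
   polynomials, so the [trig2 (v i)] are probability densities summing to [n]. *)
Lemma toeplitz_frame n f : bmeas f ->
  exists (lam : 'I_n -> R) (v : 'I_n -> 'rV[C]_n),
  [/\ \det (toeplitz f n) = (\prod_i lam i)%:C,
      forall i, lam i = int01 (fun x => f x * trig2 (v i) x),
      forall i, int01 (trig2 (v i)) = 1,
      forall x, \sum_i trig2 (v i) x = n%:R &
      forall x, \sum_i lam i * trig2 (v i) x = cesaro f n x].
Proof.
move=> bf; set T := toeplitz f n.
have TH : T \is hermsymmx.
  by apply/is_hermitianmxP; rewrite expr0 scale1r toeplitz_herm.
pose U := spectralmx T; pose d := spectral_diag T.
have UU : U *m U^t* = 1%:M by apply/unitarymxP; exact: spectral_unitarymx.
have UU' : U^t* *m U = 1%:M by exact: mulmx1C.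
have TE : T = U^t* *m diag_mx d *m U.
  rewrite -invmx_unitary ?spectral_unitarymx//.
  by apply/orthomx_spectralP/hermitian_normalmx.
pose lam i : R := Re (d 0 i); pose v i := row i U.
have dlam i : d 0 i = (lam i)%:C.
  have := hermitian_spectral_diag_real TH => /mxOverP/(_ 0 i)/RRe_real <-.
  by [].
have UTU : U *m T *m U^t* = diag_mx d.
  by rewrite TE !mulmxA UU mul1mx -mulmxA UU mulmx1.
have quad g i : bmeas g ->
    (int01 (fun x => g x * trig2 (v i) x))%:C = (U *m toeplitz g n *m U^t*) i i.
  move=> bg; rewrite -toeplitz_quad// /v !mxE.
  apply: eq_bigr => j _; rewrite !mxE; congr (_ * _).
  by apply: eq_bigr => l _; rewrite !mxE.
have eU x i : (evec n x *m U^t*) 0 i = conjc (trig (v i) x).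
  rewrite mxE /trig rmorph_sum; apply: eq_bigr => j _.
  by rewrite !mxE rmorphM mulrC.
(* Coordinates of [evec n x] in the eigenbasis; their squared moduli are the [trig2 (v i) x]. The
   norm of the vector gives their sum, and its quadratic form gives the sum weighted by the
   eigenvalues. *)
pose b x := evec n x *m U^t*.
have bt x : (b x)^t* = U *m (evec n x)^t* by rewrite /b trmx_mul map_mxM trmxCK.
have bsq x i : (trig2 (v i) x)%:C = b x 0 i * conjc (b x 0 i).
  by rewrite /b eU /trig2 -nsq_conj nsqE.
exists lam, v; split.
- rewrite TE !det_mulmx mulrAC -det_mulmx UU' det1 mul1r det_diag rmorph_prod.
  by apply: eq_bigr => i _; rewrite dlam.
- move=> i; apply: complexI; rewrite quad// UTU mxE eqxx mulr1n; exact/esym/dlam.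
- move=> i; apply: complexI.
  (* Normalization is the quadratic form of the constant 1, whose Toeplitz matrix is the
     identity. *)
  have -> : trig2 (v i) = fun x => 1 * trig2 (v i) x by apply/funext => x; rewrite mul1r.
  by rewrite quad ?toeplitz1 ?mulmx1 ?UU ?mxE ?eqxx//; exact: bmeas_cst.
- move=> x; apply: complexI; rewrite rmorph_sum/= rmorph_nat.
  have : (b x *m (b x)^t*) 0 0 = n%:R.
    by rewrite bt /b -mulmxA (mulmxA _ U) UU' mul1mx evec_norm mxE eqxx mulr1n.
  by move=> <-; rewrite mxE; apply: eq_bigr => i _; rewrite bsq !mxE.
- move=> x; apply: complexI; rewrite rmorph_sum -toeplitz_quad//.
  have -> : evec n x *m T *m (evec n x)^t* = b x *m diag_mx d *m (b x)^t*.
    by rewrite bt /b TE !mulmxA.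
  rewrite mxE; apply: eq_bigr => i _.
  by rewrite mul_mx_diag !mxE rmorphM/= bsq -dlam /b; rewrite !mxE; ring.
Qed.

End toeplitz.

(** * Fejer means *)

Section fejer.
Local Open Scope complex_scope.
Variable R : realType.
Implicit Types f h : R -> R.
Local Notation C := R[i].

Lemma cesaroE n f x : bmeas f -> (cesaro f n x)%:C =
  \sum_(i < n) \sum_(j < n) fourier_coef f (j%:Z - i%:Z) * ek (j%:Z - i%:Z) x.
Proof.
move=> bf; rewrite -toeplitz_quad// mxE.
under eq_bigr => j _ do rewrite !mxE mulr_suml.
rewrite exchange_big; apply: eq_bigr => i _; apply: eq_bigr => j _.
rewrite !mxE -[X in _ * X]/(conjc _) conjcK ekD ekN; ring.
Qed.

Lemma cbmeas_cesaro_sum n f :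
  cbmeas (fun x => \sum_(i < n) \sum_(j < n) fourier_coef f (j%:Z - i%:Z) * ek (j%:Z - i%:Z) x).
Proof.
apply: cbmeas_sum => i; apply: cbmeas_sum => j.
by apply: cbmeasM; [exact: cbmeas_cst|exact: cbmeas_ek].
Qed.

Lemma bmeas_cesaro n f : bmeas f -> bmeas (cesaro f n).
Proof.
move=> bf; have [+ _] := cbmeas_cesaro_sum n f.
by congr bmeas; apply/funext => x /=; rewrite -cesaroE.
Qed.

(** Self-adjointness of the Fejer operator: both sides are the same double sum of products of
    opposite Fourier coefficients, with the indices exchanged. *)
Lemma cesaro_pairing n f h : bmeas f -> bmeas h ->
  int01 (fun x => h x * cesaro f n x) = int01 (fun x => f x * cesaro h n x).
Proof.
have E (u w : R -> R) : bmeas u -> bmeas w ->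
    (int01 (fun x => w x * cesaro u n x))%:C = \sum_(i < n) \sum_(j < n)
      fourier_coef u (j%:Z - i%:Z) * fourier_coef w (i%:Z - j%:Z).
  move=> bu bw; rewrite -torus_integralC_real.
  have bc (c : C) k : cbmeas (fun x => c * ((w x)%:C * ek k x)).
    apply: cbmeasM; first exact: cbmeas_cst.
    by apply: cbmeasM; [exact: cbmeas_real|exact: cbmeas_ek].
  have -> : (fun x => (w x * cesaro u n x)%:C) = fun x => \sum_(i < n) \sum_(j < n)
      fourier_coef u (j%:Z - i%:Z) * ((w x)%:C * ek (- (i%:Z - j%:Z)) x).
    apply/funext => x; rewrite rmorphM/= cesaroE// mulr_sumr.
    apply: eq_bigr => i _; rewrite mulr_sumr; apply: eq_bigr => j _.
    by rewrite opprB mulrCA.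
  rewrite torus_integralC_sum; last by move=> i; exact: cbmeas_sum.
  apply: eq_bigr => i _; rewrite torus_integralC_sum//; apply: eq_bigr => j _.
  rewrite torus_integralCZ -?fourier_coefE//.
  by apply: cbmeasM; [exact: cbmeas_real|exact: cbmeas_ek].
move=> bf bh; apply: complexI.
rewrite (E _ _ bf bh) (E _ _ bh bf) exchange_big.
by apply: eq_bigr => i _; apply: eq_bigr => j _; rewrite mulrC.
Qed.

Lemma cesaro1 n x : @cesaro R (fun=> 1) n x = n%:R.
Proof.
apply: complexI; rewrite /cesaro -toeplitz_quad; last exact: bmeas_cst.
by rewrite toeplitz1 mulmx1 evec_norm mxE eqxx mulr1n rmorph_nat.
Qed.

Lemma int01_fejer n (x : R) : int01 (trig2 (evec n x)) = n%:R.
Proof.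
rewrite -[RHS](cesaro1 n x); congr int01.
by apply/funext => y; rewrite mul1r.
Qed.

Lemma cesaro_le n f h x : bmeas f -> bmeas h ->
  (forall y, 0 <= y < 1 -> f y <= h y) -> cesaro f n x <= cesaro h n x.
Proof.
move=> bf bh fh; apply: le_int01 => [||y y01]; try (apply: bmeasM => //; exact: bmeas_trig2).
by rewrite ler_wpM2r ?trig2_ge0 ?fh.
Qed.

Lemma ler_norm_cesaro n f (M x : R) : bmeas f -> (forall y, `|f y| <= M) ->
  `|cesaro f n x| <= M * n%:R.
Proof.
move=> bf fM; have bt := bmeas_trig2 (evec n x).
have bft : bmeas (fun y => f y * trig2 (evec n x) y) by exact: bmeasM.
apply: le_trans (ler_norm_int01 bft) _.
rewrite -(int01_fejer n x) -int01Z//; apply: le_int01 => [||y _].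
- exact: bmeas_norm.
- by apply: bmeasM => //; exact: bmeas_cst.
- by rewrite normrM [X in _ * X]ger0_norm ?trig2_ge0// ler_wpM2r ?trig2_ge0.
Qed.

Lemma cesaro_affine n f (a b : R) x : bmeas f ->
  cesaro (fun y => a + b * f y) n x = a * n%:R + b * cesaro f n x.
Proof.
move=> bf; have b1 := bmeas_trig2 (evec n x).
have b2 : bmeas (fun y => f y * trig2 (evec n x) y) by exact: bmeasM.
rewrite /cesaro -(int01_fejer n x) -(int01Z a b1) -(int01Z b b2) -int01D.
- by congr int01; apply/funext => y; rewrite mulrDl mulrA.
- by apply: bmeasM => //; exact: bmeas_cst.
- by apply: bmeasM => //; exact: bmeas_cst.
Qed.

(** The kernel is the squared modulus of a geometric sum in [z]: times [|z - 1|^2 = 2 (1 - cos)] it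
    becomes [|z^n - 1|^2 <= 4]. This bounds the kernel away from [x] uniformly in [n]. *)
Lemma fejer_le n (x y : R) : trig2 (evec n x) y * (1 - cos (2 * pi * (y - x))) <= 2.
Proof.
pose z : C := ek 1 (y - x).
have tE : trig (evec n x) y = \sum_(i < n) z ^+ i.
  apply: eq_bigr => i _; rewrite mxE.
  have -> : conjc (ek i%:Z x) * ek i%:Z y = ek i%:Z (y - x).
    by rewrite /ek -cisN -cisD; congr cis; ring.
  elim: (i : nat) => [|k ih]; first by rewrite ek0 expr0.
  by rewrite exprS -ih /z intS ekD.
have nz m : nsq (z ^+ m) = 1.
  elim: m => [|m ih]; first by rewrite expr0 -(nsq_ek 0 0) ek0.
  by rewrite exprS nsqM ih mulr1 nsq_ek.
have n1 : nsq (z - 1) = 2 * (1 - cos (2 * pi * (y - x))).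
  rewrite /nsq /z /ek /cis /= mulr1.
  have := cos2Dsin2 (2 * pi * (y - x)); set c := cos _; set s := sin _ => cs.
  have -> : (s - 0) ^+ 2 = 1 - c ^+ 2 by rewrite subr0 -cs addrC addKr.
  by ring.
have h1 := nsqM (z - 1) (\sum_(i < n) z ^+ i).
rewrite -subrX1 n1 -tE -/(trig2 _ _) in h1.
have h2 := nsq_le2 (z ^+ n) 1.
rewrite nz h1 -[X in nsq X](ek0 x) nsq_ek in h2.
move: h2; move: (trig2 _ _) (cos _) => a b; lra.
Qed.

(** As a function of [|y - x|], the right side vanishes at 0 and at 1; an interior [x] keeps
    [|y - x|] away from 1 as well. *)
Lemma cos_gap (x eta : R) : 0 < x < 1 -> 0 < eta ->
  exists2 c : R, 0 < c &
  forall y, 0 <= y < 1 -> eta <= `|y - x| -> c <= 1 - cos (2 * pi * (y - x)).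
Proof.
move=> /andP[x0 x1] eta0.
(* The bounds by [x] and [1 - x] give [|y - x| <= 1 - e], so that the symmetry [t -> 1 - t] reduces
   to [t <= 1 / 2]. *)
pose e := Num.min eta (Num.min x (1 - x)).
have e0 : 0 < e by rewrite !lt_min eta0 x0 subr_gt0.
have [ex ex'] : e <= x /\ e <= 1 - x.
  by split; rewrite !ge_min lexx ?orbT.
have pi0 := pi_gt0 R.
have itv (t : R) : 0 <= t -> t <= 1 / 2 -> 2 * pi * t \in `[0, pi].
  by move=> t0 t1; rewrite in_itv/=; apply/andP; split; nra.
have e12 : e <= 1 / 2 by lra.
exists (1 - cos (2 * pi * e)).
  have z_in : (0 : R) \in `[0, pi] by rewrite in_itv/= lexx ltW.
  by rewrite subr_gt0 -[X in _ < X]cos0 ltr_cos ?itv ?(ltW e0)// !mulr_gt0.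
move=> y /andP[y0 y1] ey; rewrite lerD2l lerN2.
have -> : cos (2 * pi * (y - x)) = cos (2 * pi * `|y - x|).
  by case: (ler0P (y - x)) => // _; rewrite mulrN cosN.
have et : e <= `|y - x| by apply: le_trans ey; rewrite ge_min lexx.
have te : `|y - x| <= 1 - e by rewrite ler_norml; lra.
move: (`|y - x|) et te => t et te.
have main s : e <= s -> s <= 1 / 2 -> cos (2 * pi * s) <= cos (2 * pi * e).
  move=> es s12; rewrite leNgt ltr_cos ?itv// -?leNgt; try lra.
  by rewrite ler_pM2l// mulr_gt0.
have [t12|t12] := leP t (1 / 2); first exact: main.
have -> : cos (2 * pi * t) = cos (2 * pi * (1 - t)).
  have -> : 2 * pi * (1 - t) = - (2 * pi * t) + pi *+ 2 by rewrite mulr2n; ring.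
  by rewrite cosD2pi cosN.
by apply: main; lra.
Qed.

(** The oscillation of [h] about [h x] is at most [eps / 2 + D * k y] with [k = 1 - cos]: continuity
    gives this near [x], and [cos_gap] elsewhere. The unnormalized mean of [k] at [x] is at most 2,
    so after division by [n] its term tends to 0. *)
Lemma fejer_cvg h (M x : R) : continuous h -> (forall y, `|h y| <= M) -> 0 < x < 1 ->
  n%:R^-1 * cesaro h n x @[n --> \oo] --> h x.
Proof.
move=> ch hM x01; apply/cvgrPdist_le => eps eps0.
have bh : bmeas h by exact: continuous_bmeas hM.
have eps2 : 0 < eps / 2 by rewrite divr_gt0.
have /cvgrPdist_le/(_ _ eps2)[eta /= eta0 heta] := ch x.
have [c c0 hc] := cos_gap x01 eta0.
pose k := fun y => 1 - cos (2 * pi * (y - x)).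
have k0 y : 0 <= k y by rewrite subr_ge0 cos_le1.
have bk : bmeas k.
  apply: bmeasB; first exact: bmeas_cst.
  apply: (@continuous_bmeas _ _ 1) => [y|y]; last exact: cos_max.
  apply: continuous_comp; last exact: continuous_cos.
  by apply: continuous_comp; [apply: continuousB; [exact: cvg_id|exact: cvg_cst]|exact: mulrl_continuous].
(* Chosen so that [D * c] is [2 * M], a bound on the oscillation of [h]. *)
pose D := 2 * M / c.
have M0 : 0 <= M by exact: le_trans (normr_ge0 _) (hM 0).
have D0 : 0 <= D by rewrite divr_ge0 ?mulr_ge0// ltW.
have osc y : 0 <= y < 1 -> `|h y - h x| <= eps / 2 + D * k y.
  move=> y01; have [yx|yx] := ltP `|y - x| eta.
    rewrite distrC; apply: le_trans (heta y _) _; first by rewrite /= distrC.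
    by rewrite lerDl mulr_ge0.
  apply: (@le_trans _ _ (2 * M)).
    by apply: le_trans (ler_normB _ _) _; have := hM x; have := hM y; lra.
  have : D * c <= D * k y by rewrite ler_wpM2l// hc.
  rewrite /D divfK ?gt_eqF// => h'; lra.
have kn n : cesaro k n x <= 2.
  rewrite -[leRHS](int01_cst 2); apply: le_int01 => [||y _].
  - by apply: bmeasM => //; exact: bmeas_trig2.
  - exact: bmeas_cst.
  - by rewrite mulrC fejer_le.
have main n : `|cesaro h n x - n%:R * h x| <= eps / 2 * n%:R + D * 2.
  have bd : bmeas (fun y => eps / 2 + D * k y).
    by apply: bmeasD; [exact: bmeas_cst|apply: bmeasM => //; exact: bmeas_cst].
  have U : cesaro (fun y => eps / 2 + D * k y) n x <= eps / 2 * n%:R + D * 2.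
    by rewrite cesaro_affine// lerD2l ler_wpM2l.
  have b1 : bmeas (fun y => - h x + 1 * h y).
    by apply: bmeasD; [exact: bmeas_cst|apply: bmeasM => //; exact: bmeas_cst].
  have b2 : bmeas (fun y => h x + (-1) * h y).
    by apply: bmeasD; [exact: bmeas_cst|apply: bmeasM => //; exact: bmeas_cst].
  rewrite ler_norml; apply/andP; split.
    rewrite lerNl; apply: le_trans U.
    have := @cesaro_le n (fun y => h x + (-1) * h y) _ x b2 bd; rewrite cesaro_affine//.
    move=> /(_ _)H; apply: le_trans (H _); first by rewrite mulrC; lra.
    move=> y /osc; rewrite ler_norml => /andP[]; lra.
  apply: le_trans U.
  have := @cesaro_le n (fun y => - h x + 1 * h y) _ x b1 bd; rewrite cesaro_affine//.
  move=> /(_ _)H; apply: le_trans (H _); first by rewrite mulrC; lra.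
  move=> y /osc; rewrite ler_norml => /andP[]; lra.
near=> n.
have n0 : 0 < n%:R :> R by rewrite ltr0n; near: n; exact: nbhs_infty_gt.
rewrite distrC -(ler_pM2l n0) -{1}(ger0_norm (ltW n0)) -normrM mulrBr mulrA divff ?gt_eqF// mul1r.
apply: le_trans (main n) _.
have : D * 2 <= n%:R * (eps / 2).
  rewrite -ler_pdivrMr//; near: n; exact: nbhs_infty_ger.
by lra.
Unshelve. all: by end_near.
Qed.

End fejer.

(** * Fejer means paired with bounded functions *)

Section szego.
Variable R : realType.
Implicit Types f h g : R -> R.
Local Notation mu := (@lebesgue_measure R).
Local Notation I01 := (`[0 : R, 1[%classic).

(** Continuous functions are dense in the mean; truncating one to [[- M, M]], where [h] takes its
    values, does not increase its distance to [h]. *)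
Lemma continuous_approx h (M delta : R) : bmeas h -> (forall x, `|h x| <= M) ->
  0 < delta -> exists g, [/\ continuous g, forall x, `|g x| <= M &
    int01 (fun x => `|h x - g x|) <= delta].
Proof.
move=> bh hM delta0.
have M0 : 0 <= M by exact: le_trans (normr_ge0 _) (hM 0).
have muI : (mu I01 < +oo)%E by rewrite [ltLHS]lebesgue_I01 ltry.
have [g_ [cg ig hg]] := approximation_continuous_integrable
  (measurable_itv _) muI (bmeas_integrable bh).
have : \forall n \near \oo, (\int[mu]_(z in I01) `|(h z - g_ n z)%:E| <= delta%:E)%E.
  move/fine_cvgP : hg => [fing /cvgrPdist_le/(_ _ delta0) hd].
  near=> n; rewrite -[leLHS]fineK; last by near: n.
  rewrite lee_fin; apply: le_trans (ler_norm _) _.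
  by rewrite -normrN -sub0r; near: n.
move=> [n _ /(_ n (leqnn n)) hn].
pose g x := Num.min (Num.max (g_ n x) (- M)) M.
have cgg : continuous g.
  move=> x; apply: (@continuous_min _ _ (fun x => Num.max (g_ n x) (- M) : R^o) (fun=> M : R^o)).
    apply: (@continuous_max _ _ (g_ n : R -> R^o) (fun=> - M : R^o)); first exact: cg.
    exact: cvg_cst.
  exact: cvg_cst.
have gM x : `|g x| <= M.
  rewrite /g ler_norml; move: (g_ n x) => t.
  case: (leP t (- M)) => tM; [case: (leP (- M) M)|case: (leP t M)] => ?;
  by apply/andP; split; lra.
have gh x : `|h x - g x| <= `|h x - g_ n x|.
  have := hM x; rewrite ler_norml => /andP[h1 h2].
  have k1 := ler_norm (h x - g_ n x); have k2 := lerNnormlW (lexx `|h x - g_ n x|).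
  have k3 := normr_ge0 (h x - g_ n x).
  rewrite /g ler_norml; move: k1 k2 k3; move: `|h x - g_ n x| (g_ n x) => N t k1 k2 k3.
  clear -M0 h1 h2 k1 k2 k3; case: (leP t (- M)) => tM; [case: (leP (- M) M)|case: (leP t M)] => ?;
  by apply/andP; split; lra.
exists g; split=> //.
have bg : bmeas g by exact: continuous_bmeas gM.
have bhg : bmeas (fun x => `|h x - g x|) by apply: bmeas_norm; exact: bmeasB.
rewrite -lee_fin; apply: le_trans hn.
rewrite /int01 /Rintegral fineK; last exact/integrable_fin_num/bmeas_integrable.
apply: ge0_le_integral => //.
- by apply/measurable_EFinP; apply: measurable_funTS; case: bhg.
- apply: measurableT_comp => //; apply/measurable_EFinP.
  apply: measurable_funB; first by apply: measurable_funTS; case: bh.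
  by apply: measurable_funTS; apply: continuous_measurable_fun; exact: cg.
- by move=> x _; rewrite lee_fin; exact: gh.
Unshelve. all: by end_near. Qed.

Section bounded_density.
Variable f : R -> R.
Hypothesis bf : bmeas f.
Hypothesis f01 : forall x, 0 <= f x <= 1.

Lemma cesaro_itv n x : 0 <= cesaro f n x <= n%:R.
Proof.
apply/andP; split.
  apply: int01_ge0 => [|y _]; first by apply: bmeasM => //; exact: bmeas_trig2.
  by rewrite mulr_ge0 ?trig2_ge0//; case/andP: (f01 y).
rewrite -(cesaro1 n x); apply: cesaro_le => // [|y _]; first exact: bmeas_cst.
by case/andP: (f01 y).
Qed.

(* By duality the Cesaro means may be moved to a continuous approximation of
   [h], where they converge pointwise. *)
Lemma cesaro_weak_limit h (delta : R) : bmeas h -> 0 < delta ->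
  \forall n \near \oo, n%:R^-1 * int01 (fun x => h x * cesaro f n x) <=
    int01 (fun x => f x * h x) + delta.
Proof.
move=> bh delta0; have [M hM] := bh.2.
have d3 : 0 < delta / 3 by rewrite divr_gt0.
have [g [cg gM hg]] := continuous_approx bh hM d3.
have bg : bmeas g by exact: continuous_bmeas gM.
have bhg : bmeas (fun x => h x - g x) by exact: bmeasB.
have bnhg := bmeas_norm bhg.
have bcf n : bmeas (cesaro f n) by exact: bmeas_cesaro.
have bcg n : bmeas (cesaro g n) by exact: bmeas_cesaro.
have lim : int01 (fun x => f x * (n%:R^-1 * cesaro g n x)) @[n --> \oo] -->
    int01 (fun x => f x * g x).
  apply: (@dominated_int01 _ _ _ M).
  - move=> n; apply: bmeasM => //; apply: bmeasM => //; exact: bmeas_cst.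
  - exact: bmeasM.
  - move=> n x _; have M0 : 0 <= M by exact: le_trans (normr_ge0 _) (hM 0).
    have gn : `|cesaro g n x| <= M * n%:R by exact: ler_norm_cesaro.
    rewrite normrM normrM ger0_norm; last by case/andP: (f01 x).
    rewrite ger0_norm ?invr_ge0 ?ler0n//.
    have [n0|n0] := posnP n; first by rewrite n0 invr0 mul0r mulr0.
    have h1 : n%:R^-1 * `|cesaro g n x| <= M by rewrite mulrC ler_pdivrMr ?ltr0n.
    apply: le_trans h1; rewrite ler_piMl//; last by case/andP: (f01 x).
  - move=> x x01; apply: cvgM; first exact: cvg_cst.
    exact: (fejer_cvg cg gM).
have /cvgrPdist_le/(_ _ d3) near1 := lim.
near=> n.
have n0 : 0 < n%:R :> R by rewrite ltr0n; near: n; exact: nbhs_infty_gt.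
(* The three errors of [delta / 3] come from replacing [h] by [g] against the Cesaro mean, from the
   limit for [g], and from returning to [h] against [f]. *)
have e1 : int01 (fun x => h x * cesaro f n x) =
    int01 (fun x => (h x - g x) * cesaro f n x) + int01 (fun x => f x * cesaro g n x).
  rewrite -(cesaro_pairing n bf bg) -int01D; try exact: bmeasM.
  by congr int01; apply/funext => x; rewrite -mulrDl subrK.
have e2 : n%:R^-1 * int01 (fun x => (h x - g x) * cesaro f n x) <= delta / 3.
  rewrite mulrC ler_pdivrMr//; apply: (@le_trans _ _ (int01 (fun x => n%:R * `|h x - g x|))).
    apply: le_int01 => [||x _]; [exact: bmeasM| |].
      by apply: bmeasM => //; exact: bmeas_cst.
    have /andP[c0 c1] := cesaro_itv n x.
    apply: le_trans (ler_wpM2r c0 (ler_norm _)) _.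
    by rewrite mulrC ler_wpM2r.
  by rewrite int01Z// mulrC ler_pM2r.
have e3 : n%:R^-1 * int01 (fun x => f x * cesaro g n x) <= int01 (fun x => f x * g x) + delta / 3.
  rewrite -int01Z; last exact: bmeasM.
  have -> : (fun x => n%:R^-1 * (f x * cesaro g n x)) = fun x => f x * (n%:R^-1 * cesaro g n x).
    by apply/funext => x; rewrite mulrCA.
  by apply: ler_distlCDr; near: n.
have e4 : int01 (fun x => f x * g x) <= int01 (fun x => f x * h x) + delta / 3.
  apply: le_trans (_ : int01 (fun x => f x * h x + `|h x - g x|) <= _).
    apply: le_int01 => [||x _]; [exact: bmeasM| |].
      by apply: bmeasD => //; exact: bmeasM.
    have /andP[f0 f1] := f01 x.
    by apply: ler_distlCDr; rewrite -mulrBr normrM ger0_norm// ler_piMl.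
  rewrite int01D//; [by rewrite lerD2l|exact: bmeasM].
rewrite e1 mulrDr; apply: le_trans (lerD e2 (le_trans e3 (lerD e4 (lexx _)))) _.
move: (int01 _) => c; clear; lra.
Unshelve. all: by end_near. Qed.

End bounded_density.
End szego.

(** * Bounds on Toeplitz determinants by the geometric mean *)

Section limit.
Variable R : realType.
Local Notation mu := (@lebesgue_measure R).
Local Notation I01 := (`[0 : R, 1[%classic).

Lemma le_ln_tangent (x c : R) : 0 < x -> 0 < c -> ln x <= x / c - 1 + ln c.
Proof.
move=> x0 c0; have xc : 0 < x / c by rewrite divr_gt0.
have -> : ln x = ln (x / c) + ln c by rewrite -lnM ?posrE// divfK ?gt_eqF.
rewrite lerD2r; have := @le_ln1Dx R (x / c - 1).
by rewrite addrCA subrr addr0; apply; rewrite ltrBrDl subrr.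
Qed.

Lemma ln_prod n (l : 'I_n -> R) : (forall i, 0 < l i) ->
  ln (\prod_i l i) = \sum_i ln (l i).
Proof.
elim: n l => [|n ih] l l0; first by rewrite !big_ord0 ln1.
rewrite !big_ord_recl lnM ?posrE//; first by rewrite ih.
by apply: prodr_gt0 => i _.
Qed.

(** A bound linear in [e], with a constant independent of [e], used to let [e] tend to 0 in the
    product of shifted eigenvalues. *)
Lemma prod_shift_le n (l : 'I_n -> R) : (forall i, 0 <= l i) ->
  exists2 K : R, 0 <= K &
  forall e, 0 < e <= 1 -> \prod_i (l i + e) <= \prod_i l i + K * e.
Proof.
elim: n l => [|n ih] l l0.
  by exists 0 => // e _; rewrite !big_ord0 mul0r addr0.
have [K K0 hK] := ih (fun i => l (lift ord0 i)) (fun i => l0 _).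
set P := \prod_i l (lift ord0 i) in hK.
have P0 : 0 <= P by exact: prodr_ge0.
(* From expanding [(l ord0 + e) * (P + K * e)] with [e * e <= e]. *)
exists (P + K * (l ord0 + 1)); first by rewrite addr_ge0// mulr_ge0// addr_ge0.
move=> e e01; have /andP[e0 e1] := e01; rewrite !big_ord_recl -/P.
have := hK e e01; set Q := \prod_i _ => PQ.
have l00 := l0 ord0; have le0 : 0 <= l ord0 + e by rewrite addr_ge0// ltW.
apply: le_trans (ler_wpM2l le0 PQ) _.
have : K * e * e <= K * e * 1 by rewrite ler_wpM2l// mulr_ge0// ltW.
lra.
Qed.

Section density.
Variable f : R -> R.
Hypothesis bf : bmeas f.
Hypothesis f01 : forall x, 0 <= f x <= 1.

Let f_ge0 x : 0 <= f x. Proof. by case/andP: (f01 x). Qed.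

(** The shift keeps the logarithm bounded where [f] vanishes, so both Szego bounds are proved with
    bounded functions; [le_GM] then relates the shifted integrals to [GM f]. *)
Lemma bmeas_ln_shift (e : R) : 0 < e <= 1 -> bmeas (fun x => ln (f x + e)).
Proof.
move=> /andP[e0 e1]; split.
  apply: measurableT_comp => //; apply: measurable_funD; first by case: bf.
  exact: measurable_cst.
exists (`|ln e| + `|ln 2|) => x; have := f01 x => /andP[f0 f1].
have h1 : ln e <= ln (f x + e) by rewrite ler_ln ?posrE//; lra.
have h2 : ln (f x + e) <= ln 2 by rewrite ler_ln ?posrE//; lra.
have := ler_norm (ln 2 : R); have := lerNnormlW (lexx `|ln e|).
have := normr_ge0 (ln e); have := normr_ge0 (ln 2 : R).
by rewrite ler_norml => *; apply/andP; split; lra.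
Qed.

Lemma bmeas_inv_shift (e : R) : 0 < e <= 1 -> bmeas (fun x => (f x + e)^-1).
Proof.
move=> /andP[e0 e1]; split.
  rewrite (_ : (fun x => _) = fun x => expR (- ln (f x + e))).
    apply: measurableT_comp => //; apply: measurableT_comp => //.
    by have [] := @bmeas_ln_shift e; first by rewrite e0.
  apply/funext => x; have fe : 0 < f x + e by rewrite ltr_wpDl.
  by rewrite expRN lnK// posrE.
exists e^-1 => x; have fe : 0 < f x + e by rewrite ltr_wpDl.
by rewrite ger0_norm ?invr_ge0 ?(ltW fe)// lef_pV2 ?posrE// lerDr.
Qed.

(* The tangent line of [ln] at [f x + e] bounds [ln (lam i)], with weight
   [trig2 (v i) x]; summing over [i] gives the Cesaro means of [f], whose
   pairing with [1 / (f + e)] tends to at most 1. *)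
Lemma szego_upper (d : nat -> R) (p : R) : 0 < p ->
  (forall n, (d n)%:C%C = \det (toeplitz f n)) ->
  (forall n, p ^+ n <= d n) ->
  forall e, 0 < e <= 1 -> ln p <= int01 (fun x => ln (f x + e)).
Proof.
move=> p0 dE pd e e01; have /andP[e0 _] := e01.
set L := int01 _; apply/ler_addgt0Pr => delta delta0.
have fe0 x : 0 < f x + e by rewrite ltr_wpDl.
pose h x := (f x + e)^-1.
have bh : bmeas h by exact: bmeas_inv_shift.
have bl := bmeas_ln_shift e01.
have fh : int01 (fun x => f x * h x) <= 1.
  rewrite -[leRHS](int01_cst 1); apply: le_int01 => [||x _].
  - exact: bmeasM.
  - exact: bmeas_cst.
  - by rewrite /h ler_pdivrMr// mul1r lerDl ltW.
have [N _ hN] := cesaro_weak_limit bf f01 bh delta0.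
(* The successor makes [n] positive, as the final division by [n] requires. *)
pose n := N.+1; have {}hN := hN n (leqnSn N).
have n0 : 0 < n%:R :> R by rewrite ltr0n.
have [lam [v [det_lam lamE v1 sv slam]]] := toeplitz_frame n bf.
have dlam : d n = \prod_i lam i by apply: complexI; rewrite dE.
have lam_ge0 i : 0 <= lam i.
  rewrite lamE; apply: int01_ge0 => [|x _]; first by apply: bmeasM => //; exact: bmeas_trig2.
  by rewrite mulr_ge0 ?trig2_ge0.
have lam_gt0 i : 0 < lam i.
  rewrite lt_neqAle lam_ge0 andbT; apply/eqP => li.
  have : p ^+ n <= 0 by rewrite (le_trans (pd n))// dlam (bigD1 i)//= -li mul0r.
  by rewrite leNgt exprn_gt0.
have bw i : bmeas (trig2 (v i)) by exact: bmeas_trig2.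
have bZ c g : bmeas g -> bmeas (fun x : R => c * g x).
  by apply: bmeasM; exact: bmeas_cst.
have key : ln (d n) <= int01 (fun x => h x * cesaro f n x) - n%:R + n%:R * L.
  have -> : ln (d n) = int01 (fun x => \sum_i ln (lam i) * trig2 (v i) x).
    rewrite dlam ln_prod// int01_sum; last by move=> i; exact: bZ.
    by apply: eq_bigr => i _; rewrite int01Z// v1 mulr1.
  have bhc : bmeas (fun x => h x * cesaro f n x) by apply: bmeasM => //; exact: bmeas_cesaro.
  rewrite -[X in _ - X](int01_cst n%:R) -int01B//; last exact: bmeas_cst.
  rewrite -int01Z// -int01D//; [|by apply: bmeasB => //; exact: bmeas_cst|exact: bZ].
  apply: le_int01 => [||x _].
  - by apply: bmeas_sum => i; exact: bZ.
  - by apply: bmeasD; [apply: bmeasB => //; exact: bmeas_cst|exact: bZ].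
  - rewrite -(slam x) -(sv x) mulr_sumr mulr_suml -sumrB -big_split/=.
    apply: ler_sum => i _.
    have := ler_wpM2r (trig2_ge0 (v i) x) (le_ln_tangent (lam_gt0 i) (fe0 x)).
    by rewrite -/(h x); lra.
have lnd : n%:R * ln p <= ln (d n).
  rewrite mulr_natl -lnXn// ler_ln ?posrE ?exprn_gt0//.
  by apply: lt_le_trans (pd n); rewrite exprn_gt0.
have hN' : int01 (fun x => h x * cesaro f n x) <= n%:R * (1 + delta).
  rewrite -ler_pdivrMl//; apply: le_trans hN _; lra.
rewrite -(ler_pM2l n0); lra.
Qed.

(* Jensen's inequality for [ln] and each probability density [trig2 (v i)]. *)
Lemma szego_lower (d : nat -> R) (p : R) : 0 < p ->
  (forall n, (d n)%:C%C = \det (toeplitz f n)) ->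
  (forall e, 0 < e <= 1 -> ln p <= int01 (fun x => ln (f x + e))) ->
  forall n, p ^+ n <= d n.
Proof.
move=> p0 dE pL n.
have [lam [v [det_lam lamE v1 sv _]]] := toeplitz_frame n bf.
have dlam : d n = \prod_i lam i by apply: complexI; rewrite dE.
have bw i : bmeas (trig2 (v i)) by exact: bmeas_trig2.
have lam_ge0 i : 0 <= lam i.
  rewrite lamE; apply: int01_ge0 => [|x _]; first by exact: bmeasM.
  by rewrite mulr_ge0 ?trig2_ge0.
have main e : 0 < e <= 1 -> p ^+ n <= \prod_i (lam i + e).
  move=> e01; have /andP[e0 _] := e01; have bl := bmeas_ln_shift e01.
  have fe0 x : 0 < f x + e by rewrite ltr_wpDl.
  have le0 i : 0 < lam i + e by rewrite ltr_wpDl.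
  have P0 : 0 < \prod_i (lam i + e) by apply: prodr_gt0 => i _.
  rewrite -ler_ln ?posrE ?exprn_gt0// lnXn// -mulr_natl ln_prod//.
  apply: le_trans (ler_wpM2l (ler0n _ _) (pL e e01)) _.
  have -> : n%:R * int01 (fun x => ln (f x + e)) =
      \sum_i int01 (fun x => trig2 (v i) x * ln (f x + e)).
    rewrite -int01Z// -int01_sum; last by move=> i; exact: bmeasM.
    by congr int01; apply/funext => x; rewrite -mulr_suml sv.
  apply: ler_sum => i _.
  (* The tangent is taken at the mean of [f + e] under the density [trig2 (v i)], so that its linear
     part integrates to 0. *)
  pose c := lam i + e.
  have bfw : bmeas (fun x => f x * trig2 (v i) x) by exact: bmeasM.
  have bZ k g : bmeas g -> bmeas (fun x : R => k * g x).
    by apply: bmeasM; exact: bmeas_cst.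
  apply: (@le_trans _ _ (int01 (fun x => c^-1 * (f x * trig2 (v i) x) +
      (e / c - 1 + ln c) * trig2 (v i) x))).
    apply: le_int01 => [||x _]; first exact: bmeasM.
      by apply: bmeasD; exact: bZ.
    have := ler_wpM2l (trig2_ge0 (v i) x) (le_ln_tangent (fe0 x) (le0 i)).
    by rewrite -/c mulrDl; lra.
  rewrite int01D; [|exact: bZ|exact: bZ].
  rewrite !int01Z// v1 -lamE mulr1 addrA addrA [c^-1 * _]mulrC -mulrDl -/c divff.
    by rewrite subrr add0r.
  by rewrite gt_eqF//; exact: le0.
have [K K0 hK] := prod_shift_le lam_ge0.
rewrite dlam; apply/ler_addgt0Pr => delta delta0.
(* Small enough for [K * e <= delta]; the added 1 covers [K = 0]. *)
pose e := Num.min 1 (delta / (K + 1)).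
have K1 : 0 < K + 1 by rewrite ltr_wpDl.
have e0 : 0 < e by rewrite lt_min ltr01 divr_gt0.
have e1 : e <= 1 by rewrite ge_min lexx.
apply: le_trans (main e _) _; first by rewrite e0.
apply: le_trans (hK e _) _; first by rewrite e0.
rewrite lerD2l.
have : e * (K + 1) <= delta by rewrite -ler_pdivlMr// ge_min lexx orbT.
by lra.
Qed.

(** As [e] decreases to 0, [ln 2 - ln (f + e)] increases to [ln 2 - ln f], and monotone convergence
    applies even if the limit has infinite integral. The direct implication only needs
    [ln f <= ln (f + e)]. *)
Lemma le_GM (p : R) : 0 < p ->
  (p%:E <= GM f)%E <->
  (forall e, 0 < e <= 1 -> ln p <= int01 (fun x => ln (f x + e))).
Proof.
move=> p0.
pose G x : \bar R := (- lne (f x)%:E)%E.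
have G0 x : (0 <= G x)%E.
  by rewrite /G oppe_ge0 lne_le0 lee_fin; case/andP: (f01 x).
have GE : GM f = expeR (- \int[mu]_(x in I01) G x)%E.
  rewrite /GM; congr expeR; rewrite -integral_ge0N//.
  by apply: eq_integral => x _; rewrite /G oppeK.
have -> : (p%:E <= GM f)%E = (\int[mu]_(x in I01) G x <= (- ln p)%:E)%E.
  rewrite GE; have -> : p%:E = expeR (ln p)%:E by rewrite /= lnK// posrE.
  by rewrite lee_expeR EFinN leeNr.
(* Since [f + e <= 2], the constant [ln 2] makes [H] nonnegative. *)
pose H e x := ln 2 - ln (f x + e).
have bH e : 0 < e <= 1 -> bmeas (H e).
  by move=> e01; apply: bmeasB; [exact: bmeas_cst|exact: bmeas_ln_shift].
have H0 e x : 0 < e <= 1 -> 0 <= H e x.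
  move=> /andP[e0 e1]; have /andP[f0 f1] := f01 x.
  by rewrite subr_ge0 ler_ln ?posrE//; lra.
have intH e : 0 < e <= 1 -> (\int[mu]_(x in I01) (H e x)%:E)%E =
    (ln 2 - int01 (fun x => ln (f x + e)))%:E.
  move=> e01; rewrite -[X in X - _](int01_cst (ln 2)) -int01B; first last.
  - exact: bmeas_ln_shift.
  - exact: bmeas_cst.
  rewrite /int01 /Rintegral fineK//.
  by apply: integrable_fin_num => //; exact: bmeas_integrable (bH e e01).
pose e_ (k : nat) : R := k.+1%:R^-1.
have e_01 k : 0 < e_ k <= 1.
  by rewrite invr_gt0 ltr0n invf_le1 ?ler1n ?ltr0n.
have cvgH x : (H (e_ k) x)%:E @[k --> \oo] --> ((ln 2)%:E + G x)%E.
  have [fx|fx] := leP (f x) 0.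
    have fx0 : f x = 0 by apply/le_anti; rewrite fx f_ge0.
    rewrite /G fx0 le0_lneNy// addey//.
    apply/cvgeyPge => A; near=> k.
    rewrite lee_fin /H fx0 add0r lnV ?posrE// opprK.
    have : expR A <= k.+1%:R :> R.
      by rewrite (@le_trans _ _ k%:R) ?ler_nat//; near: k; exact: nbhs_infty_ger.
    rewrite -ler_ln ?posrE ?expR_gt0// expRK => h.
    by apply: le_trans h _; rewrite lerDr ln_ge0// ler1n.
  rewrite /G lne_EFin// -EFinN -EFinD; apply: cvg_EFin; first exact: nearW.
  apply: cvgB; first exact: cvg_cst.
  apply: continuous_cvg; first exact: continuous_ln.
  rewrite -[X in _ --> X]addr0; apply: cvgD; first exact: cvg_cst.
  exact: cvg_harmonic.
have mH k : measurable_fun I01 (fun x => (H (e_ k) x)%:E).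
  by apply/measurable_EFinP; apply: measurable_funTS; case: (bH _ (e_01 k)).
(* The extended logarithm is measurable as a pointwise limit of the shifted ones. *)
have mHl : measurable_fun I01 (fun x => (ln 2)%:E + G x)%E.
  by apply: (@emeasurable_fun_cvg _ _ R _ (fun k x => (H (e_ k) x)%:E) _ mH) => x _; exact: cvgH.
have ln20 : (0 <= (ln 2 : R)%:E)%E by rewrite lee_fin ln_ge0// ler1n.
have mG : measurable_fun I01 G.
  rewrite (_ : G = fun x => ((ln 2)%:E + G x - (ln 2)%:E)%E).
    by apply: emeasurable_funB => //; exact: measurable_cst.
  by apply/funext => x; rewrite addeAC subee// add0e.
have intG : (\int[mu]_(x in I01) ((ln 2)%:E + G x) =
    (ln 2)%:E + \int[mu]_(x in I01) G x)%E.
  rewrite ge0_integralD//.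
  by rewrite integral_cst// [X in (_ * X)%E]lebesgue_I01 mule1.
split=> [Gp e e01|hp].
  have : (\int[mu]_(x in I01) (H e x)%:E <= \int[mu]_(x in I01) ((ln 2)%:E + G x))%E.
    apply: ge0_le_integral => //.
    - by move=> x _; rewrite lee_fin H0.
    - by apply/measurable_EFinP; apply: measurable_funTS; case: (bH _ e01).
    - move=> x _; have /andP[e0 _] := e01; rewrite /H /G EFinB leeD2l//.
      have [fx|fx] := leP (f x) 0; first by rewrite le0_lneNy ?lee_fin// leey.
      by rewrite lne_EFin// -EFinN lee_fin lerN2 ler_ln ?posrE ?addr_gt0// lerDl ltW.
  rewrite intH// intG => h; have := le_trans h (leeD2l (ln 2)%:E Gp).
  by rewrite -EFinD lee_fin; lra.
have ndH x : I01 x -> {homo (fun k => (H (e_ k) x)%:E) : m n / (m <= n)%N >-> (m <= n)%E}.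
  move=> _ m n mn; rewrite lee_fin lerD2l lerN2.
  have /andP[em0 _] := e_01 m; have /andP[en0 _] := e_01 n.
  rewrite ler_ln ?posrE ?ltr_wpDl// lerD2l lef_pV2 ?posrE ?ltr0n// ler_nat ltnS//.
have := @cvg_monotone_convergence _ _ R mu I01 (measurable_itv _)
  (fun k x => (H (e_ k) x)%:E) mH (fun k x _ => H0 _ x (e_01 k)) ndH.
have -> : (\int[mu]_(x in I01) limn (fun k => (H (e_ k) x)%:E) =
    \int[mu]_(x in I01) ((ln 2)%:E + G x))%E.
  by apply: eq_integral => x _; apply/cvg_lim => //; exact: cvgH.
rewrite intG => lim.
rewrite -(leeD2lE (x := (ln 2)%:E))// -EFinD.
apply: (cvge_to_le lim); apply: nearW => k; rewrite intH// lee_fin lerD2l lerN2.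
exact: hp.
Unshelve. all: by end_near. Qed.

End density.
End limit.

(** * Exchanging zeros and ones *)

Definition flip (eta : config) : config := fun i => ~~ eta i.

Lemma flipK : involutive flip.
Proof. by move=> eta; apply/funext => i; rewrite /flip negbK. Qed.

(** Open sets are countable unions of box events, and the preimage of a box event is the one with
    negated words. *)
Lemma measurable_flip : measurable_fun [set: config] flip.
Proof.
apply: (@measurability _ _ _ _ setT flip (@open (prod_topology (fun _ : int => bool)))) => //.
move=> _ [U oU <-]; rewrite setTI -(bigcup_box_interior oU) preimage_bigcup.
apply: bigcupT_measurable => N; rewrite /box_interior; set g := (X in word_event _ _ X).
rewrite (_ : _ @^-1` _ = word_event (- N%:Z) N.*2.+1 (g \o map negb)).
  exact: measurable_word_event.
by apply/seteqP; split=> eta; rewrite /word_event /= /word -map_comp.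
Qed.

HB.instance Definition _ := isMeasurableFun.Build _ _ config config flip measurable_flip.

Section flip.
Variable R : realType.
Implicit Types P : probability config R.

Definition flipP P : probability config R := distribution P flip.

Lemma flipPE P A : flipP P A = P (flip @^-1` A).
Proof. by []. Qed.

Lemma measurable_preimage_flip A : measurable A -> measurable (flip @^-1` A).
Proof. by move=> mA; rewrite -[X in measurable X]setTI; exact: measurable_flip. Qed.

Lemma flip_cyl n (e : 'I_n -> int) (a : 'I_n -> bool) :
  flip @^-1` cyl e a = cyl e (fun i => ~~ a i).
Proof.
by apply/seteqP; split=> eta h i; have := h i; rewrite /flip /=; case: (eta _) (a i) => [] [].
Qed.

Lemma flip_bernoulli p P : bernoulli_product p P -> bernoulli_product (1 - p) (flipP P).
Proof.
move=> hP n e a ie; rewrite flipPE [X in P X](flip_cyl e a) [LHS]hP//; congr EFin.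
by apply: eq_bigr => i _; case: (a i); rewrite ?subKr.
Qed.

(** The preimage of an increasing event under [flip] is decreasing; passing to its complement
    reverses the inequality. *)
Lemma flip_dominated P Q : stoch_dominated P Q -> stoch_dominated (flipP Q) (flipP P).
Proof.
move=> PQ A mA iA; rewrite !flipPE.
have mF := measurable_preimage_flip mA.
pose B : set config := ~` (flip @^-1` A).
have mB : measurable B by exact: measurableC.
have iB : increasing_event B.
  move=> eta delta Be ed Ad; apply: Be; apply: iA Ad _ => i.
  by move: (ed i); rewrite /flip; case: (eta i) (delta i) => [] [].
have E (S : probability config R) : S (flip @^-1` A) = (1 - S B)%E.
  by rewrite -probability_setC// /B setCK.
by rewrite [leLHS]E [leRHS]E leeB// PQ.
Qed.

(** Flipping negates the conditioning pattern and turns the conditional probability of a 1 into that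
    of a 0. *)
Lemma flip_strong P p :
  product_strongly_dominated (1 - p) (flipP P) <-> strongly_dominated_product P p.
Proof.
have fe n (a : 'I_n -> bool) :
    flip @^-1` future_event a = future_event (fun i => ~~ a i).
  exact: (flip_cyl (fun i : 'I_n => i.+1%:Z)).
have mfe n (a : 'I_n -> bool) : measurable (future_event a).
  exact: (measurable_cyl (fun i : 'I_n => i.+1%:Z)).
have cond n (a : 'I_n -> bool) : (0 < P (future_event (fun i => ~~ a i)))%E ->
    cond_prob (flipP P) (future_event a) [set eta | eta 0 = true] =
    1 - cond_prob P (future_event (fun i => ~~ a i)) [set eta | eta 0 = true].
  set F := future_event _ => F0.
  have mF : measurable F by exact: mfe.
  have F0' : 0 < fine (P F) by rewrite fine_gt0// F0 ltey_eq fin_num_measure.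
  rewrite /cond_prob !flipPE preimage_setI [X in _ / X](congr1 (fine \o P) (fe n a)).
  rewrite /= -/F fe -/F.
  have -> : fine (P (flip @^-1` [set eta | eta 0 = true] `&` F)) =
      fine (P F) - fine (P ([set eta | eta 0 = true] `&` F)).
    apply/eqP; rewrite eq_sym subr_eq; apply/eqP.
    have -> : flip @^-1` [set eta | eta 0 = true] = [set eta | eta 0 = false].
      by apply/seteqP; split=> eta; rewrite /flip /=; case: (eta 0).
    have mc b : measurable ([set eta : config | eta 0 = b] `&` F).
      by apply: measurableI => //; exact: measurable_coord.
    rewrite -fineD ?fin_num_measure// -measureU//; last first.
      by apply/seteqP; split=> eta //= [[-> _] []].
    congr (fine (P _)); apply/seteqP; split=> [eta Fe|eta [[]|[]]//].
    by case e : (eta 0); [right|left].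
  by rewrite mulrBl divff ?gt_eqF.
split=> h n a a0.
- have := h n (fun i => ~~ a i).
  have -> : flipP P (future_event (fun i => ~~ a i)) = P (future_event a).
    rewrite flipPE fe; congr (P (future_event _)).
    by apply/funext => i; rewrite negbK.
  have {}cond := cond n (fun i => ~~ a i).
  have aK : (fun i => ~~ ~~ a i) = a by apply/funext => i; rewrite negbK.
  by rewrite aK in cond => /(_ a0); rewrite cond// lerD2l lerN2.
- rewrite flipPE fe in a0.
  by rewrite cond// lerD2l lerN2; exact: h.
Qed.

End flip.

Section flip_determinantal.
Variables (R : realType) (f : R -> R) (P : probability config R).
Hypothesis bf : bmeas f.
Hypothesis Pdet : determinantal f P.

Lemma fourier_coef_onem k :
  fourier_coef (fun x => 1 - f x) k = (k == 0)%:R - fourier_coef f k.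
Proof.
rewrite -fourier_coef1 !fourier_coefE -[- torus_integralC _]mulN1r -torus_integralCZ; last first.
  by apply: cbmeasM; [exact: cbmeas_real|exact: cbmeas_ek].
rewrite -torus_integralCD.
- congr torus_integralC; apply/funext => x; rewrite rmorphB /=; ring.
- by apply: cbmeasM; [apply: cbmeas_real; exact: bmeas_cst|exact: cbmeas_ek].
- apply: cbmeasM; first exact: cbmeas_cst.
  by apply: cbmeasM; [exact: cbmeas_real|exact: cbmeas_ek].
Qed.

(** Ones of the flipped process are zeros of the original one, and the all-zero pattern has
    probability [(-1)^n det (K - I) = det (I - K)]. *)
Lemma flip_is_determinantal : determinantal (fun x => 1 - f x) (flipP P).
Proof.
move=> n e n0 ie.
rewrite flipPE [X in P X](flip_cyl e (fun=> true)).
have kN m : fourier_coef f (- m) = (fourier_coef f m)^* by exact: fourier_coefN.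
rewrite (@cyl_det R (fourier_coef f) P Pdet)//.
rewrite /pattern_sign prodr_const card_ord -detZ; congr (\det _).
apply/matrixP => i j; rewrite !mxE fourier_coef_onem subr_eq0 (inj_eq ie) eq_sym.
by rewrite andbT mulN1r opprB.
Qed.

End flip_determinantal.

(** * The equivalences *)

Section equivalences.
Variable R : realType.
Implicit Types (nu mu : probability config R) (f : R -> R).

Lemma map_fst_window m a : map fst (window m a) = [seq m + k%:Z | k <- iota 0 (size a)].
Proof.
rewrite /window -map_comp (eq_map (_ : _ =1 (fun k : nat => m + k%:Z) \o fst))// map_comp.
by rewrite -/unzip1 unzip1_zip// size_iota.
Qed.

Lemma uniq_window m a : uniq (map fst (window m a)).
Proof. by rewrite map_fst_window map_inj_uniq ?iota_uniq// => x y; lia. Qed.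

Lemma uniq_window_cons m b a : uniq (map fst ((m, b) :: window (m + 1) a)).
Proof. by rewrite -window_cons uniq_window. Qed.

Lemma shift_window c m a : shift_pat c (window m a) = window (m + c) a.
Proof. by rewrite /shift_pat -map_comp; apply: eq_map => x /=; rewrite addrAC. Qed.

Lemma future_event_codom n (a : 'I_n -> bool) :
  future_event a = pat (window 1 (codom a)).
Proof.
have sa : size (codom a) = n by rewrite size_codom card_ord.
have nthE (i : 'I_n) : nth true (codom a) i = a i.
  by rewrite /codom /image_mem (nth_map i) -?cardE ?card_ord// nth_ord_enum.
apply/seteqP; split=> eta.
  move=> h; apply/pat_window; rewrite sa.
  apply: (@eq_from_nth _ true) => [|i]; first by rewrite size_map size_iota sa.
  rewrite size_map size_iota => ni; rewrite (nth_map 0%N) ?size_iota// nth_iota//.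
  by rewrite (nthE (Ordinal ni)) -h /= add0n -intS.
move/pat_window; rewrite sa => e i; rewrite -nthE -e.
by rewrite (nth_map 0%N) ?size_iota// nth_iota// add0n -intS.
Qed.

Lemma future_event_nth (s : seq bool) :
  future_event (fun i : 'I_(size s) => nth true s i) = pat (window 1 s).
Proof.
rewrite future_event_codom; congr (pat (window 1 _)).
apply: (@eq_from_nth _ true); rewrite size_codom card_ord// => i si.
rewrite /codom /image_mem (nth_map (Ordinal si)) -?cardE ?card_ord//.
by rewrite (nth_ord_enum _ (Ordinal si)).
Qed.

(** In the form without denominators, windows of probability 0 satisfy the inequality trivially. *)
Lemma product_strongly_dominatedP p nu : 0 <= p ->
  product_strongly_dominated p nu <->
  (forall a, p * patP nu (window 1 a) <= patP nu ((0, true) :: window 1 a)).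
Proof.
move=> p0; split=> h.
- move=> a; have [w0|w0] := ltrP 0 (patP nu (window 1 a)); last first.
    by apply: le_trans (patP_ge0 _ _); rewrite mulr_ge0_le0.
  have := h _ (fun i : 'I_(size a) => nth true a i).
  rewrite future_event_nth -patP_EFin lte_fin => /(_ w0).
  by rewrite /cond_prob -pat_cons ler_pdivlMr.
- move=> n a; rewrite future_event_codom -patP_EFin lte_fin => w0.
  by rewrite /cond_prob -pat_cons ler_pdivlMr//; exact: h.
Qed.

Lemma bernoulli_patP p mu s : bernoulli_product p mu -> uniq (map fst s) ->
  patP mu s = \prod_(i < size s) (if seq_val i then p else 1 - p).
Proof. by move=> bmu us; rewrite /patP pat_cyl [X in fine X]bmu//; exact: seq_pos_inj. Qed.

Lemma bernoulli_cons p mu i s : bernoulli_product p mu -> uniq (map fst ((i, true) :: s)) ->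
  patP mu ((i, true) :: s) = p * patP mu s.
Proof.
move=> bmu us; rewrite !(bernoulli_patP bmu)//; last by case/andP: us.
by rewrite big_ord_recl.
Qed.

Lemma bernoulli_ones p mu m n : bernoulli_product p mu -> patP mu (ones m n) = p ^+ n.
Proof.
move=> bmu; elim: n m => [|n ih] m; first by rewrite /ones /= patP_nil.
by rewrite onesS (bernoulli_cons bmu) ?ih ?exprS// -onesS uniq_ones.
Qed.

Lemma increasing_ones m n : increasing_event (pat (ones m n)).
Proof.
move=> eta delta /allP h ed; apply/allP => x xo.
move: (h x xo) (ed x.1); case: x xo => i b; rewrite mem_ones /= => /andP[_ ->] /eqP ->.
by case: (delta i).
Qed.

Lemma ones_of_domination p mu_p nu n : bernoulli_product p mu_p ->
  stoch_dominated mu_p nu -> p ^+ n <= patP nu (ones 1 n).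
Proof.
move=> bmu dom; rewrite -(bernoulli_ones 1 n bmu) -lee_fin !patP_EFin.
by apply: dom; [exact: measurable_pat|exact: increasing_ones].
Qed.

Lemma strong_of_ones p nu : 0 <= p ->
  (forall k s, uniq (map fst s) -> patP nu (shift_pat k s) = patP nu s) ->
  pairwise_cond_neg_corr nu -> (forall n, p ^+ n <= patP nu (ones 1 n)) ->
  product_strongly_dominated p nu.
Proof.
by move=> p0 sh pnc po; apply/product_strongly_dominatedP => // a; exact: strong_window.
Qed.

(** Strong domination concerns the origin and the sites after it; shift invariance moves it to every
    window, while under [mu_p] a further 1 costs exactly the factor [p]. *)
Lemma domination_of_strong p mu_p nu : 0 <= p <= 1 -> bernoulli_product p mu_p ->
  (forall k s, uniq (map fst s) -> patP nu (shift_pat k s) = patP nu s) ->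
  product_strongly_dominated p nu -> stoch_dominated mu_p nu.
Proof.
move=> p01 bmu sh /product_strongly_dominatedP st.
have p0 : 0 <= p by case/andP: p01.
apply: (window_domination p01) => m a; last first.
  by rewrite (bernoulli_cons bmu)// uniq_window_cons.
have := st p0 a; rewrite -(sh m _ (uniq_window 1 a)) shift_window.
rewrite -(sh m ((0, true) :: window 1 a)); last exact: (uniq_window_cons 0).
by rewrite /= shift_window add0r [1 + m]addrC.
Qed.

Lemma stationary_shift mu : stationary mu ->
  forall k s, patP mu (shift_pat k s) = patP mu s.
Proof.
move=> st k s; rewrite /patP -(st k (pat s) (measurable_pat s)); congr (fine (mu _)).
by apply/seteqP; split=> eta; rewrite /pat /shift_pat /= all_map.
Qed.

Lemma uniq_fst_inj (s : seq (int * bool)) k b c : uniq (map fst s) ->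
  (k, b) \in s -> (k, c) \in s -> b = c.
Proof.
elim: s => //= -[k' b'] s ih /andP[/= ks us]; rewrite !inE.
have nks d : (k', d) \in s -> False by move=> ds; move/negP: ks; apply; exact: (map_f fst ds).
move=> /predU1P[[e1 e2]|kb] /predU1P[[e3 e4]|kc].
- by rewrite e2 e4.
- by rewrite e1 in kc; case: (nks _ kc).
- by rewrite e3 in kb; case: (nks _ kb).
- exact: ih.
Qed.

(** Negative association given [s] is applied to two increasing events, a 1 at [i] and a 1 at
    [j]. *)
Lemma cond_na_pnc mu : cond_negatively_associated mu -> pairwise_cond_neg_corr mu.
Proof.
move=> na i j s /= us.
have [s0|s0] := ltrP 0 (patP mu s); last first.
  have -> : patP mu s = 0 by apply/le_anti; rewrite s0 patP_ge0.
  by rewrite mulr0 mulr_ge0 ?patP_ge0.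
(* The pattern [s] extended by 0; distinctness of its sites makes the extension agree with [s]. *)
pose eta0 : config := fun k => (k, true) \in s.
pose A : set int := [set` map fst s].
have us' : uniq (map fst s) by case/and3P: us.
have CE : [set eta : config | forall k, A k -> eta k = eta0 k] = pat s.
  have val0 k b : (k, b) \in s -> eta0 k = b.
    move=> kb; rewrite /eta0; case: b kb => // kb; apply/negP => kt.
    by have := uniq_fst_inj us' kb kt.
  apply/seteqP; split=> eta h.
    by apply/allP => -[k b] kb; rewrite /= h ?(val0 _ _ kb)//=; apply/mapP; exists (k, b).
  move=> k /mapP[[k' b] kb /= ->]; rewrite (val0 _ _ kb).
  by move/allP : h => /(_ _ kb)/eqP.
have := na A eta0 (finite_seq _); rewrite /= CE -patP_EFin lte_fin => /(_ s0).
move=> /(_ [set i] [set j] [set eta | eta i = true] [set eta | eta j = true]).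
have ij : i != j by case/andP: us; rewrite inE negb_or => /andP[].
have dis : [set i] `&` [set j] = set0.
  by apply/seteqP; split=> // x [/= -> ji]; rewrite ji eqxx in ij.
have sg k : coord_sigma_algebra [set k] [set eta | eta k = true].
  by apply: sub_sigma_algebra; exists k.
have inc k : increasing_event [set eta | eta k = true].
  by move=> eta delta /= e /(_ k); rewrite e; case: (delta k).
move=> /(_ dis (sg i) (sg j) (inc i) (inc j)).
rewrite /cond_prob -setIA -!pat_cons -/(patP mu s) -/(patP mu (_ :: s)).
rewrite -/(patP mu ((j, true) :: s)) -/(patP mu [:: (i, true), (j, true) & s]).
move: (patP _ _) (patP _ _) (patP _ _) (patP _ _) s0 => c b a d d0.
have -> : b / d * (c / d) = b * c / d / d by rewrite mulf_div invfM mulrA.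
by rewrite ler_pM2r ?invr_gt0// ler_pdivlMr.
Qed.

Lemma le_GM_ones f (Pf : probability config R) p : torus_measurable f ->
  (forall x, 0 <= f x <= 1) -> determinantal f Pf -> 0 <= p ->
  (p%:E <= GM f)%E <-> (forall n, p ^+ n <= patP Pf (ones 1 n)).
Proof.
move=> tf f01 Pdet; rewrite le_eqVlt => /predU1P[<-|p0].
  (* For [p = 0], where no logarithm is available, both sides hold; at [n = 0] the bound is
     [0 ^+ 0 = 1], the probability of the empty pattern. *)
  split=> _; last exact: expeR_ge0.
  by case=> [|n]; rewrite ?expr0n ?patP_ge0//= /ones/= patP_nil.
have bf : bmeas f.
  by split; [case: tf|exists 1 => x; have /andP[? ?] := f01 x; rewrite ger0_norm].
have dE n : (patP Pf (ones 1 n))%:C%C = \det (toeplitz f n).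
  exact: (@determinantal_ones R (fourier_coef f) Pf Pdet n).
split=> [/(le_GM bf f01 p0)|h]; first exact: szego_lower dE.
by apply/(le_GM bf f01 p0); exact: szego_upper dE h.
Qed.

Lemma determinantal_equivalence f (Pf mu_p : probability config R) p :
  torus_measurable f -> (forall x, 0 <= f x <= 1) -> determinantal f Pf ->
  0 <= p <= 1 -> bernoulli_product p mu_p ->
  [<-> stoch_dominated mu_p Pf; (p%:E <= GM f)%E; product_strongly_dominated p Pf].
Proof.
move=> tf f01 Pdet p01 bmu; have /andP[p0 _] := p01.
have bf : bmeas f.
  by split; [case: tf|exists 1 => x; have /andP[? ?] := f01 x; rewrite ger0_norm].
have kN m : fourier_coef f (- m) = ((fourier_coef f m)^*)%R by exact: fourier_coefN.
have sh := @determinantal_shift R (fourier_coef f) Pf Pdet.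
tfae.
- move=> dom; apply/(le_GM_ones tf f01 Pdet p0) => n.
  exact: ones_of_domination bmu dom.
- move/(le_GM_ones tf f01 Pdet p0); apply: strong_of_ones => //.
  exact: determinantal_pnc kN Pdet.
- exact: domination_of_strong.
Qed.

End equivalences.

Theorem theorem5p3 (R : realType) :
  (forall (f : R -> R) (Pf : probability config R),
     torus_measurable f -> (forall x, 0 <= f x <= 1) -> determinantal f Pf ->
     (forall (p : R) (mu_p : probability config R),
        0 <= p <= 1 -> bernoulli_product p mu_p ->
        [<-> stoch_dominated mu_p Pf;
             (p%:E <= GM f)%E;
             product_strongly_dominated p Pf]) /\
     (forall (q : R) (mu_q : probability config R),
        0 <= q <= 1 -> bernoulli_product q mu_q ->
        [<-> stoch_dominated Pf mu_q;
             (1 - GM (fun x => 1 - f x)%R <= q%:E)%E;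
             strongly_dominated_product Pf q])) /\
  (forall (mu : probability config R),
     stationary mu -> cond_negatively_associated mu ->
     forall (p : R) (mu_p : probability config R),
       0 <= p <= 1 -> bernoulli_product p mu_p ->
       (stoch_dominated mu_p mu <-> product_strongly_dominated p mu)).
Proof.
split=> [f Pf tf f01 Pdet|mu st na p mu_p p01 bmu]; last first.
  have sh := stationary_shift st; have /andP[p0 _] := p01; split=> h.
    apply: strong_of_ones => //; first exact: cond_na_pnc.
    by move=> n; exact: ones_of_domination bmu h.
  by apply: domination_of_strong bmu _ h => // k s _.
split=> [p mu_p p01 bmu|q mu_q q01 bmu]; first exact: determinantal_equivalence.
have bf : bmeas f.
  by split; [case: tf|exists 1 => x; have /andP[? ?] := f01 x; rewrite ger0_norm].
have tf' : torus_measurable (fun x => 1 - f x).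
  split; last by move=> x; rewrite tf.2.
  by apply: measurable_funB; [exact: measurable_cst|exact: tf.1].
have f01' x : 0 <= 1 - f x <= 1 by have /andP[? ?] := f01 x; apply/andP; split; lra.
have q01' : 0 <= 1 - q <= 1 by have /andP[? ?] := q01; apply/andP; split; lra.
(* The first equivalence for the flipped measures, with [1 - f] and [1 - q]; its three conditions
   are then translated back. *)
have E := determinantal_equivalence tf' f01' (flip_is_determinantal bf Pdet) q01'
  (flip_bernoulli bmu).
(* As [GM] is nonnegative, the value [-oo] is excluded; at [+oo] both inequalities hold. *)
have GMq : (1 - GM (fun x => 1 - f x)%R <= q%:E)%E <->
    ((1 - q)%:E <= GM (fun x => 1 - f x)%R)%E.
  have := expeR_ge0 (\int[@lebesgue_measure R]_(x in `[0%R, 1%R[) lne (1 - f x)%:E)%E.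
  rewrite -/(GM (fun x => 1 - f x)).
  case: (GM _) => [r| |] //= _; last by rewrite leey leNye.
  by rewrite -EFinB !lee_fin; split; lra.
have flipPK (P : probability config R) A : flipP (flipP P) A = P A.
  rewrite !flipPE; congr (P _); apply/seteqP; split=> eta; rewrite /= ?flipK//.
tfae.
- move=> dom; apply/GMq; apply/(E 0 1)%N; exact: flip_dominated.
- move=> /GMq h; apply/flip_strong; exact/(E 1 2)%N.
- move=> /flip_strong h A mA iA; rewrite -(flipPK Pf) -(flipPK mu_q).
  by apply: flip_dominated mA iA; exact/(E 2 0)%N.
Qed.
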